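(* Let $\tau,\beta\in\mathbb C^2$ be constant vectors and let $V_{\tau,\beta}$ be the logarithmic acceleration field on the coefficient cone which fixes the base point and satisfies $\delta\xi^{(1)}=0$, $\delta(\xi_1^{(2)},\xi_2^{(2)})=\tau\,(\beta\cdot(\xi_1^{(1)},\xi_2^{(1)}))^2$, $\delta\xi_3^{(2)}=0$, with parameter component $\sum_\alpha q_\alpha^{\log}\partial_{a_\alpha}$ given by the corrected parameter polynomial $\sum_\alpha q_\alpha^{\log}(z,a)Y^\alpha$ defined in the context. After the coefficient-Euler and cyclic-root gauge correction, this field descends to the projective parameter space, preserves the logarithmic boundary, is reparametrization equivariant, and has base twist at most $\mathcal O_{\mathbb P^2}(3)$.
   Context: On an affine chart $z=(z_1,z_2)$ of $\mathbb P^2$ let $f(z,a)=\sum_{|\alpha|\leqslant d}a_\alpha z^\alpha$ be the universal polynomial of degree $d$, $C_a=\{f(\cdot,a)=0\}$, and introduce the cyclic coordinate $z_3$ with $G:=z_3^d+f(z_1,z_2,a)=0$. Logarithmic vertical two-jets have coordinates $\xi^{(1)},\xi^{(2)}\in\mathbb C^3$ defined by $z_i'=\xi_i^{(1)}$, $z_i''=\xi_i^{(2)}$ for $i=1,2$, and $z_3'=z_3\xi_3^{(1)}$, $z_3''=z_3(\xi_3^{(2)}+(\xi_3^{(1)})^2)$. The jet equations are $E_j^{\log}=\mathscr D^jG=0$, $0\leqslant j\leqslant2$, with $\mathscr D$ total differentiation in the source variable; the logarithmic boundary is $z_3=0$. Parameter polynomial: start from $Q_0(Y;z,a)=-\frac12\bigl(\tau\cdot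 df(Y,a)\bigr)\bigl(\beta\cdot(Y-z)\bigr)^2$, of degree at most $d+1$ in $Y=(Y_1,Y_2)$; for each monomial $h_\alpha Y^\alpha$ of its part of degree $d+1$ choose $\gamma(\alpha)\leqslant\alpha$ with $|\gamma(\alpha)|=3$ and subtract $h_\alpha(Y-z)^{\gamma(\alpha)}Y^{\alpha-\gamma(\alpha)}$. The result has degree at most $d$ in $Y$ and its coefficients are the $q_\alpha^{\log}(z,a)$, linear in $a$. Gauge correction: let $\mathscr E_{\log}=\sum_\alpha a_\alpha\partial_{a_\alpha}+\frac1d z_3\partial_{z_3}$. On the coefficient chart $a_\rho\ne0$ replace $V_{\tau,\beta}$ by $V_{\tau,\beta}-\operatorname{pr}^{(2)}(c_\rho\mathscr E_{\log})$ with $c_\rho=q_\rho^{\log}/a_\rho$, where $\operatorname{pr}^{(2)}$ denotes the full second prolongation (derivatives of $c_\rho$ along jets included). ''Descends to the projective parameter space'' means that these corrected fields, tangent to the logarithmic two-jet equations, have zero $a_\rho$-component and on overlaps differ by gauge fields $\operatorname{pr}^{(2)}(c\,\mathscr E_{\log})$, hence define one field over $\mathbb P(H^0(\mathbb P^2,\mathcal O(d)))$. ''Base twist at most $\mathcal O_{\mathbb P^2}(3)$'' means that over the projective charts of $\mathbb P^2$ it is a section of the tangent sheaf of the logarithmic vertical two-jet space twisted by $\mathcal O_{\mathbb P^2}(3)$ (poles of order at most $3$ at infinity). ''Reparametrization equivariant'' means compatible with the action of the group of 2-jets of changes of parameter. *)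

(* Defs.v *)
From HB Require Import structures.
From mathcomp Require Import all_boot all_order all_algebra.
From mathcomp Require Import fraction generic_quotient.
From mathcomp Require Import reals complex.
From mathcomp Require Export mpoly.

Set Implicit Arguments.
Unset Strict Implicit.
Unset Printing Implicit Defensive.

Import GRing.Theory.
Local Open Scope ring_scope.

(* Coordinates on (z_1, z_2, z_3, a): [inl i] is z_(i+1), [inr (inl tt)] is    *)
(* the cyclic coordinate z_3, [inr (inr m)] is the coefficient a_m, |m| <= d.  *)
Definition base (d : nat) : Type := ('I_2 + (unit + 'X_{1..2 < d.+1}))%type.
HB.instance Definition _ d := Finite.on (base d).

(* Logarithmic two-jets of (z_1, z_2, z_3, a): [(k, b)] is the k-th order jet  *)
(* coordinate of b.  For z_3 these are z_3, xi_3^(1), xi_3^(2), that is, z_3   *)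
(* and the first two derivatives of log z_3.  The jets a^(1), a^(2) of the     *)
(* coefficients are coordinates as well, because prolonging c_rho * E produces *)
(* the components (c_rho a_m)' and (c_rho a_m)''; the vertical two-jets are    *)
(* the locus a^(1) = a^(2) = 0.                                                *)
Definition coord (d : nat) : Type := ('I_3 * base d)%type.
HB.instance Definition _ d := Finite.on (coord d).

Notation jetpoly R d := {mpoly (complex R)[#|{: coord d}|]}.
Notation jetfun R d := {fraction (jetpoly R d)}.

Notation zc k i := ((k, inl i) : coord _).
Notation rc k := ((k, inr (inl tt)) : coord _).
Notation ac k m := ((k, inr (inr m)) : coord _).

Notation k0 := (@Ordinal 3 0 isT).
Notation k1 := (@Ordinal 3 1 isT).
Notation k2 := (@Ordinal 3 2 isT).

Section Jets.
Variables (R : realType) (d : nat).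
Local Notation C := (complex R).
Local Notation P := (jetpoly R d).
Local Notation F := (jetfun R d).
Local Notation "p %:F" := (@FracField.tofrac P p).

Definition pX (x : coord d) : P := 'X_(enum_rank x).
Definition cX (x : coord d) : F := (pX x)%:F.

Definition cst (c : C) : F := (c%:MP : P)%:F.

(* Partial derivative of a rational function, by the quotient rule. *)
Definition pd (x : coord d) (g : F) : F :=
  let: p := \n_(repr g) in let: q := \d_(repr g) in
  ((p^`M(enum_rank x))%:F * q%:F - p%:F * (q^`M(enum_rank x))%:F) / q%:F ^+ 2.

(* A vector field is given by its components, one for each coordinate. *)
Definition vfield := coord d -> F.

Definition lie (V : vfield) (g : F) : F := \sum_x V x * pd x g.

(* Total differentiation in the source variable, truncated at order two: it is *)
(* only meant to be applied to functions of jet order at most one.             *)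
Definition Dfield : vfield := fun x =>
  match x with
  | (k, inr (inl tt)) =>
      if k == 0%N :> nat then cX (rc k0) * cX (rc k1)
      else if k == 1%N :> nat then cX (rc k2) else 0
  | (k, b) => if (k < 2)%N then cX (inord k.+1, b) else 0
  end.
Definition D : F -> F := lie Dfield.

Definition msubst (phi : coord d -> F) (p : P) : F :=
  mmap cst (fun i => phi (enum_val i)) p.
Definition fsubst (phi : coord d -> F) (g : F) : F :=
  msubst phi \n_(repr g) / msubst phi \d_(repr g).

(* Regular functions of the coordinate system [phi] on the locus s <> 0. *)
Definition regular (phi : coord d -> F) (s g : F) : Prop :=
  exists (N : nat) (p : P), g * s ^+ N = msubst phi p.

Definition in_ideal (phi : coord d -> F) (s : F) (I : finType) (e : I -> F)
    (g : F) : Prop :=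
  exists2 h : I -> F, (forall i, regular phi s (h i)) &
                      g = \sum_i h i * e i.

(* t * W maps the ideal generated by [e] into itself. *)
Definition preserves (phi : coord d -> F) (s t : F) (W : vfield)
    (I : finType) (e : I -> F) : Prop :=
  forall i, in_ideal phi s e (t * lie W (e i)).

Definition G : P :=
  pX (rc k0) ^+ d
  + \sum_(m : 'X_{1..2 < d.+1}) pX (ac k0 m) * \prod_(i < 2) pX (zc k0 i) ^+ (m i).

Definition Elog (j : 'I_3) : F := iter j D G%:F.

Definition acoef (m : 'X_{1..2 < d.+1}) : F := cX (ac k0 m).
Definition root3 (_ : unit) : F := cX (rc k0).
(* a^(1) and a^(2), the equations of the vertical two-jets. *)
Definition ajets (x : 'I_2 * 'X_{1..2 < d.+1}) : F := cX (ac (lift ord0 x.1) x.2).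

Section Field.
Variables (tau beta : 'rV[C]_2) (gamma : 'X_{1..2} -> 'X_{1..2}).

(* Polynomials in Y = (Y_1, Y_2), with coefficients in the functions of (z, a). *)
Definition fY : {mpoly P[2]} :=
  \sum_(m : 'X_{1..2 < d.+1}) pX (ac k0 m) *: 'X_[m].
Definition Yz (i : 'I_2) : {mpoly P[2]} := 'X_i - (pX (zc k0 i))%:MP.

Definition Q0 : {mpoly P[2]} :=
  (- (2%:R^-1))%:MP
  *: ((\sum_(i < 2) (tau 0 i)%:MP *: fY^`M(i))
      * (\sum_(i < 2) (beta 0 i)%:MP *: Yz i) ^+ 2).

Definition admissible_choice : Prop :=
  forall m, m \in msupp Q0 -> mdeg m = d.+1 ->
    (gamma m <= m)%MM /\ mdeg (gamma m) = 3.

Definition Qlog : {mpoly P[2]} :=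
  Q0 - \sum_(m <- msupp Q0 | mdeg m == d.+1)
         Q0@_m *: ((\prod_(i < 2) Yz i ^+ (gamma m i)) * 'X_[(m - gamma m)%MM]).

Definition qlog (m : 'X_{1..2 < d.+1}) : F := (Qlog@_m)%:F.

(* V_{tau,beta}, extended with zero components along a^(1), a^(2). *)
Definition accel : vfield := fun x =>
  match x with
  | (k, inl i) =>
      if k == 2%N :> nat then
        cst (tau 0 i) * (\sum_(j < 2) cst (beta 0 j) * cX (zc k1 j)) ^+ 2
      else 0
  | (_, inr (inl _)) => 0
  | (k, inr (inr m)) => if k == 0%N :> nat then qlog m else 0
  end.

(* The coefficient-Euler and cyclic-root field on (z, z_3, a). *)
Definition euler (b : base d) : F :=
  match b with
  | inl _ => 0
  | inr (inl _) => cX (rc k0) / d%:R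
  | inr (inr m) => acoef m
  end.

(* Second prolongation of a field X on (z, z_3, a).  As the jets of z_3 are    *)
(* those of log z_3, their components are the derivatives of X(z_3) / z_3.     *)
Definition prolong (X : base d -> F) : vfield := fun x =>
  match x with
  | (k, inr (inl tt)) =>
      if k == 0%N :> nat then X (inr (inl tt))
      else iter k D (X (inr (inl tt)) / cX (rc k0))
  | (k, b) => iter k D (X b)
  end.

Definition gauge (c : F) : vfield := prolong (fun b => c * euler b).

Definition order0 (c : F) : Prop :=
  forall (k : 'I_3) (b : base d), (0 < k)%N -> pd (k, b) c = 0.

Definition corrected (rho : 'X_{1..2 < d.+1}) : vfield := fun x =>
  accel x - gauge (qlog rho / acoef rho) x.

(* X - Y lies in the module generated by the gauge fields. *)
Definition gauge_congruent (s : F) (X Y : vfield) : Prop :=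
  exists l : seq (F * F),
    (forall p, p \in l -> [/\ regular cX s p.1, regular cX s p.2 & order0 p.2])
    /\ (forall x, X x - Y x = \sum_(p <- l) p.1 * gauge p.2 x).

(* Rescaling of the coefficients by mu^d and of z_3 by mu. *)
Definition rescale (mu : C) (x : coord d) : P :=
  match x with
  | (_, inr (inr _)) => mu ^+ d *: pX x
  | (k, inr (inl _)) => if k == 0%N :> nat then mu *: pX x else pX x
  | _ => pX x
  end.

(* Change of parameter with first derivative b1 and second derivative b2. *)
Definition reparam (b1 b2 : C) (x : coord d) : P :=
  if x.1 == 0%N :> nat then pX x
  else if x.1 == 1%N :> nat then b1 *: pX x
  else b1 ^+ 2 *: pX x + b2 *: pX (k1, x.2).

Definition equivariant (phi : coord d -> P) (W : vfield) : Prop :=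
  forall x, lie W (phi x)%:F = fsubst (fun y => (phi y)%:F) (W x).

Definition reparam_equivariant (W : vfield) : Prop :=
  forall b1 b2 : C, b1 != 0 -> equivariant (reparam b1 b2) W.

Definition preserves_boundary (rho : 'X_{1..2 < d.+1}) (W : vfield) : Prop :=
  preserves cX (acoef rho) 1 W root3.

(* The corrected fields define the field over the projective space of          *)
(* coefficients which on the chart a_rho <> 0 is represented by W rho.         *)
(* Quotienting by the group of rescalings, whose infinitesimal generator on    *)
(* jets is [gauge 1], gives the vertical two-jets over the projective space;   *)
(* that W rho kills a_rho makes it tangent to the slice a_rho = 1.             *)
Record descends (W : 'X_{1..2 < d.+1} -> vfield) : Prop := Descends {
  corrected_regular : forall rho x, regular cX (acoef rho) (corrected rho x);
  corrected_tangent : forall rho,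
    preserves cX (acoef rho) 1 (corrected rho) Elog;
  corrected_normalized : forall rho, corrected rho (ac k0 rho) = 0;
  corrected_overlap : forall rho sigma, exists c : F,
    [/\ order0 c, regular cX (acoef rho * acoef sigma) c &
        forall x, corrected rho x - corrected sigma x = gauge c x];
  descended_congruent : forall rho,
    gauge_congruent (acoef rho) (W rho) (corrected rho);
  descended_vertical : forall rho, preserves cX (acoef rho) 1 (W rho) ajets;
  descended_normalized : forall rho, W rho (ac k0 rho) = 0;
  descended_invariant : forall rho (mu : C), mu != 0 ->
    equivariant (rescale mu) (W rho);
  descended_overlap : forall rho sigma, exists2 c : F,
    regular cX (acoef rho * acoef sigma) c &
    forall x, W rho x - W sigma x = c * gauge 1 x }.

(* Homogeneous coordinates (X_0, X_1, X_2) = (1, z_1, z_2) of P^2, and the     *)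
(* induced coordinates on the chart X_i <> 0: the two ratios X_j / X_i, the    *)
(* cyclic coordinate z_3 / X_i (a d-th root of minus f / X_i^d), and the jets. *)
Definition hom (i : 'I_3) : F :=
  if unlift ord0 i is Some j then cX (zc k0 j) else 1.
Definition chart_root (i : 'I_3) (_ : unit) : F := cX (rc k0) / hom i.
Definition chart (i : 'I_3) (x : coord d) : F :=
  match x with
  | (k, inl l) => iter k D (hom (lift i l) / hom i)
  | (k, inr (inl _)) =>
      let w := chart_root i tt in
      if k == 0%N :> nat then w else iter k.-1 D (D w / w)
  | (_, inr (inr _)) => cX x
  end.
Definition chart_Elog (i j : 'I_3) : F := iter j D (G%:F / hom i ^+ d).

(* W is a section of the tangent sheaf, twisted by O(e), of the logarithmic    *)
(* vertical two-jet space over P^2 x {a_rho <> 0}: on the chart X_i <> 0 the   *)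
(* line at infinity is X_0 / X_i = 0.                                          *)
Definition twisted_section (e : nat) (rho : 'X_{1..2 < d.+1}) (W : vfield) : Prop :=
  forall i : 'I_3, let t := (hom ord0 / hom i) ^+ e in
  [/\ forall x, regular (chart i) (acoef rho) (t * lie W (chart i x)),
      preserves (chart i) (acoef rho) t W (chart_Elog i),
      preserves (chart i) (acoef rho) t W ajets &
      preserves (chart i) (acoef rho) t W (chart_root i)].

End Field.
End Jets.

(* Main.v *)
Require Import Defs.
From mathcomp Require Import all_boot all_order all_algebra.
From mathcomp Require Import reals complex.
From HB Require Import structures.
From mathcomp Require Import fraction generic_quotient.
From mathcomp Require Import ring zify.

(* Write V for the acceleration field, Q for the parameter polynomial, c for
   q_rho / a_rho.  Since Q_0 = - (tau . df) (beta . (Y - z))^2 / 2 up to terms of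
   order three in Y - z, V G and V (D G) vanish, and in V (D^2 G) the Hessian of Q
   cancels the term (tau . df) (beta . xi)^2 coming from the acceleration of z; thus
   V kills all the jet equations.  The prolonged gauge field of c commutes with D
   and maps G to c G, hence D^j G to D^j (c G), which lies in the ideal.

   The descended field is V - c E with E the prolongation of the constant gauge
   field.  In the chart X_i <> 0 put u = X_0 / X_i and v_j = X_j / X_i.  The field
   maps D^2 v_j to u (tau_j - v_j tau_i) (beta . xi)^2 with tau_0 = 0, and
   u^2 (beta . xi) is regular there, so the pole at u = 0 has order at most three.
   The top-degree coefficients h_alpha do not involve z, so that the q_alpha have
   degree at most three in z, which gives the same bound for the other components. *)

Set Implicit Arguments.
Unset Strict Implicit.
Unset Printing Implicit Defensive.
Import GRing.Theory.
Local Open Scope ring_scope.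

(** * Derivations of the fraction field *)

(** The exponent three has two sources. Two-jets see a polynomial in Y only modulo third order at
    the source point, so three factors Y - z are the fewest that make the correction invisible to
    the equations; each factor may cost one pole in z. On the side of the base, the acceleration is
    quadratic in the velocity, which has a pole of order two, and the division by X_i regains one
    power: 4 - 1 = 3. The fully prolonged correction does not restrict to vertical jets, because D
    (c a_m) contains a_m (D c) and c depends on z. The descended field is therefore a different one,
    congruent to it modulo gauge fields, and boundary and equivariance are shown for both. Two
    features of the encoding shape the proof. [D] is truncated, so Leibniz and commutation arguments
    only concern x, D x and D (D x). Also [pd] and [fsubst] are defined by chosen numerators and
    denominators, so their independence of the choice comes first; for substitutions it rests on
    injectivity on polynomials. *)

Lemma quotient_rule_wd (K : fieldType) (a a' b b' u u' v v' : K) :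
  u != 0 -> v != 0 -> b * u = a * v -> b' * u + b * u' = a' * v + a * v' ->
  (b' * v - b * v') / v ^+ 2 = (a' * u - a * u') / u ^+ 2.
Proof.
move=> u0 v0 e1 e2; apply/eqP; rewrite eqr_div ?expf_neq0 //; apply/eqP.
have -> : (b' * v - b * v') * u ^+ 2 = (b' * u) * (u * v) - (b * u) * u * v' by ring.
have -> : b' * u = a' * v + a * v' - b * u' by rewrite -e2; ring.
have -> : (a' * v + a * v' - b * u') * (u * v)
  = (a' * v + a * v') * (u * v) - (b * u) * u' * v by ring.
by rewrite e1; ring.
Qed.

Section FractionField.
Variable A : idomainType.
Local Notation "p %:F" := (@FracField.tofrac A p).
Local Open Scope quotient_scope.

Lemma fracE (g : {fraction A}) : g = (\n_(repr g))%:F / (\d_(repr g))%:F.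
Proof.
have dn0 : (\d_(repr g))%:F != 0 by rewrite tofrac_eq0 denom_ratioP.
apply: (mulIf dn0); rewrite divfK //.
rewrite -{1}[g]reprK; unlock FracField.tofrac; rewrite -[LHS]FracField.pi_mul.
apply/eqmodP; rewrite /= FracField.equivfE /FracField.mulf.
rewrite !numden_Ratio ?oner_neq0 ?mulr1 ?denom_ratioP //.
by rewrite mulrC.
Qed.

Lemma frac_ind (Q : {fraction A} -> Prop) :
  (forall p q, q != 0 -> Q (p%:F / q%:F)) -> forall g, Q g.
Proof. by move=> H g; rewrite [g]fracE; apply: H; apply: denom_ratioP. Qed.

Lemma eq_frac (p q p' q' : A) : q != 0 -> q' != 0 ->
  p%:F / q%:F = p'%:F / q'%:F -> p * q' = p' * q.
Proof.
move=> q0 q'0 /eqP; rewrite eqr_div ?tofrac_eq0 // -!tofracM tofrac_eq => /eqP ->.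
by [].
Qed.

(** [pd] applies the quotient rule to an arbitrary representative; differentiating p m = n q shows
    that two representatives give the same value. *)
Lemma frac_quotient_rule (dl : A -> A) :
    (forall p q, dl (p * q) = dl p * q + p * dl q) ->
  forall p q n m, q != 0 -> m != 0 -> p%:F / q%:F = n%:F / m%:F ->
  ((dl n)%:F * m%:F - n%:F * (dl m)%:F) / m%:F ^+ 2 =
  ((dl p)%:F * q%:F - p%:F * (dl q)%:F) / q%:F ^+ 2.
Proof.
move=> dlM p q n m q0 m0 /(eq_frac q0 m0) e.
apply: quotient_rule_wd; rewrite ?tofrac_eq0 //; rewrite -!tofracM -?tofracD.
  by rewrite e mulrC.
by rewrite -!dlM e mulrC.
Qed.
End FractionField.

Lemma tofrac_injective (A : idomainType) : injective (@FracField.tofrac A).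
Proof. by move=> p q /eqP; rewrite tofrac_eq => /eqP. Qed.

Section Derivation.
Variable K : fieldType.

Record derivation (dl : K -> K) : Prop := Derivation {
  derD : forall x y, dl (x + y) = dl x + dl y;
  derM : forall x y, dl (x * y) = dl x * y + x * dl y }.

Variables (dl : K -> K) (dlP : derivation dl).

Lemma der0 : dl 0 = 0.
Proof. by apply: (addrI (dl 0)); rewrite -(derD dlP) !addr0. Qed.

Lemma derN x : dl (- x) = - dl x.
Proof. by apply: (addrI (dl x)); rewrite -(derD dlP) !subrr der0. Qed.

Lemma derB x y : dl (x - y) = dl x - dl y.
Proof. by rewrite (derD dlP) derN. Qed.

Lemma der1 : dl 1 = 0.
Proof.
by apply: (addrI (dl 1)); rewrite addr0 -{3}(mulr1 1) (derM dlP) mulr1 mul1r.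
Qed.

Lemma der_sum I (r : seq I) (Q : pred I) f :
  dl (\sum_(i <- r | Q i) f i) = \sum_(i <- r | Q i) dl (f i).
Proof. by apply: (big_morph dl (derD dlP) der0). Qed.

Lemma derV x : x != 0 -> dl x^-1 = - dl x / x ^+ 2.
Proof.
move=> x0; have := derM dlP x x^-1; rewrite divff // der1 => /esym /eqP.
rewrite addrC addr_eq0 => /eqP e.
by apply: (mulfI x0); rewrite e; field.
Qed.

Lemma der_div x y : y != 0 -> dl (x / y) = (dl x * y - x * dl y) / y ^+ 2.
Proof. by move=> y0; rewrite (derM dlP) derV //; field. Qed.

Lemma derX x n : dl (x ^+ n) = n%:R * x ^+ n.-1 * dl x.
Proof.
elim: n => [|n IH]; first by rewrite expr0 der1 !mul0r.
rewrite exprS (derM dlP) IH /=; case: n {IH} => [|n] /=.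
  by rewrite expr0; ring.
by rewrite exprS; ring.
Qed.

Lemma derZ c x : dl c = 0 -> dl (c * x) = c * dl x.
Proof. by move=> c0; rewrite (derM dlP) c0 mul0r add0r. Qed.

End Derivation.

Section Comb.
Variable K : fieldType.
Lemma derivation_comb I (r : seq I) (c : I -> K) (dl : I -> K -> K) :
  (forall i, derivation (dl i)) -> derivation (fun g => \sum_(i <- r) c i * dl i g).
Proof.
move=> H; split=> x y.
  by rewrite -big_split; apply: eq_bigr => i _; rewrite (derD (H i)) mulrDr.
rewrite mulr_suml mulr_sumr -big_split; apply: eq_bigr => i _.
by rewrite (derM (H i)) /=; ring.
Qed.
End Comb.

Section FractionDerivation.
Variables (A : idomainType) (K : fieldType) (f : {rmorphism A -> K}).
Hypothesis (f_inj : injective f).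
Hypothesis (f_frac : forall Q : K -> Prop,
  (forall p q, q != 0 -> Q (f p / f q)) -> forall g, Q g).
Variables (dl : A -> A) (Dl : K -> K).
Hypotheses (dlD : forall p q, dl (p + q) = dl p + dl q)
  (dlM : forall p q, dl (p * q) = dl p * q + p * dl q)
  (DlE : forall p q, q != 0 ->
     Dl (f p / f q) = (f (dl p) * f q - f p * f (dl q)) / f q ^+ 2).

Lemma frac_derivation : derivation Dl.
Proof.
have f0 q : q != 0 -> f q != 0 by rewrite -(rmorph0 f) (inj_eq f_inj).
split; elim/f_frac=> p q q0; elim/f_frac=> p' q' q'0.
  have qq0 : q * q' != 0 by rewrite mulf_neq0.
  have -> : f p / f q + f p' / f q' = f (p * q' + p' * q) / f (q * q').
    by rewrite rmorphD !rmorphM; field; rewrite !f0.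
  rewrite !DlE // !dlD !dlM !(rmorphD, rmorphM) /=.
  by field; rewrite !f0.
have qq0 : q * q' != 0 by rewrite mulf_neq0.
have -> : f p / f q * (f p' / f q') = f (p * p') / f (q * q').
  by rewrite !rmorphM; field; rewrite !f0.
rewrite !DlE // !dlM !(rmorphD, rmorphM) /=.
by field; rewrite !f0.
Qed.

Lemma frac_derE p : dl 1 = 0 -> Dl (f p) = f (dl p).
Proof.
move=> e1; have := DlE p (oner_neq0 A).
by rewrite e1 rmorph1 rmorph0 mulr0 subr0 expr1n !divr1 mulr1.
Qed.
End FractionDerivation.

Section Jets.
Variables (R : realType) (d : nat).
Local Notation C := (complex R).
Local Notation P := (jetpoly R d).
Local Notation F := (jetfun R d).
Local Notation "p %:F" := (@FracField.tofrac P p).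
Local Notation cX := (@cX R d).
Local Notation cst := (@cst R d).
Local Notation D := (@D R d).

Lemma pd_frac x (p q : P) : q != 0 ->
  @pd R d x (p%:F / q%:F) =
  ((p^`M(enum_rank x))%:F * q%:F - p%:F * (q^`M(enum_rank x))%:F) / q%:F ^+ 2.
Proof.
move=> q0;
apply: frac_quotient_rule => //; first exact: mderivM.
  exact: denom_ratioP.
exact: fracE.
Qed.

Lemma pd_derivation x : derivation (@pd R d x).
Proof.
apply: (@frac_derivation _ _ (@FracField.tofrac P) (@tofrac_injective P)
  (@frac_ind P) (mderiv (enum_rank x))).
- by move=> p q; apply: mderivD.
- exact: mderivM.
- exact: pd_frac.
Qed.

Lemma pd_poly x (p : P) : pd x p%:F = (p^`M(enum_rank x))%:F.
Proof.
apply: (@frac_derE _ _ (@FracField.tofrac P) (mderiv (enum_rank x))).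
  exact: pd_frac.
by rewrite -(mpolyC1 _ C) mderivC.
Qed.

Lemma pd_cst x c : pd x (cst c) = 0.
Proof. by rewrite /cst pd_poly mderivC rmorph0. Qed.

Lemma pd_cX x y : pd x (cX y) = (x == y)%:R.
Proof.
rewrite pd_poly mderivX mnm1E (inj_eq enum_rank_inj) eq_sym.
case: eqP => [->|_]; last by rewrite scale0r rmorph0.
by rewrite -{1}(add0m U_(_)%MM) addmK mpolyX0 scale1r rmorph1.
Qed.

Lemma lie_derivation (V : vfield R d) : derivation (lie V).
Proof. exact: (derivation_comb _ _ pd_derivation). Qed.

Lemma lie_cX V x : lie V (cX x) = V x.
Proof.
rewrite /lie (bigD1 x) //= pd_cX eqxx mulr1 big1 ?addr0 // => y /negPf n.
by rewrite pd_cX n mulr0.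
Qed.

Lemma lie_cst V c : lie V (cst c) = 0.
Proof. by rewrite /lie big1 // => y _; rewrite pd_cst mulr0. Qed.

Lemma lieBl V W (g : F) : lie (fun x => V x - W x) g = lie V g - lie W g.
Proof. by rewrite /lie -sumrB; apply: eq_bigr => x _; rewrite mulrBl. Qed.

Lemma lieZl c V (g : F) : lie (fun x => c * V x) g = c * lie V g.
Proof. by rewrite /lie mulr_sumr; apply: eq_bigr => x _; rewrite mulrA. Qed.

Lemma D_derivation : derivation D.
Proof. exact: lie_derivation. Qed.

End Jets.

Lemma mpoly_rmorph_eq (n : nat) (A : comNzRingType) (B : nzRingType)
    (f g : {rmorphism {mpoly A[n]} -> B}) :
  (forall c, f c%:MP = g c%:MP) -> (forall i, f 'X_i = g 'X_i) -> f =1 g.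
Proof.
move=> fgC fgX p; rewrite [p]mpolyE !rmorph_sum; apply: eq_bigr => m _.
rewrite -mul_mpolyC !rmorphM fgC mpolyXE_id !rmorph_prod; congr (_ * _).
by apply: eq_bigr => i _; rewrite !rmorphXn /= fgX.
Qed.

(** * Substitution into rational functions *)

Section FractionMap.
Variables (A : idomainType) (K : fieldType) (f : {rmorphism A -> K}).
Hypothesis f_inj : injective f.
Local Notation "p %:F" := (@FracField.tofrac A p).
Variable S : {fraction A} -> K.
Hypothesis SE : forall g, S g = f \n_(repr g) / f \d_(repr g).

Let f0 q : q != 0 -> f q != 0.
Proof. by rewrite -(rmorph0 f) (inj_eq f_inj). Qed.

Lemma frac_map_frac p q : q != 0 -> S (p%:F / q%:F) = f p / f q.
Proof.
move=> q0; rewrite SE; set r := repr _.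
have d0 : \d_r != 0 by exact: denom_ratioP.
have /esym/(eq_frac d0 q0) := fracE (p%:F / q%:F); rewrite -/r => e.
apply/eqP; rewrite eqr_div ?f0 //; apply/eqP.
by rewrite -rmorphM e rmorphM mulrC.
Qed.

(** A substitution could send a nonzero denominator to 0; injectivity of [f] excludes this, which
    makes [S] additive and multiplicative. *)
Lemma frac_map_rmorph : exists s : {rmorphism {fraction A} -> K}, S =1 s.
Proof.
have S1 : S 1 = 1.
  have := frac_map_frac 1 (oner_neq0 A).
  by rewrite !rmorph1 !divr1.
have SB : zmod_morphism S.
  elim/frac_ind=> p q q0; elim/frac_ind=> p' q' q'0.
  have qq0 : q * q' != 0 by rewrite mulf_neq0.
  rewrite -mulNr addf_div ?tofrac_eq0 // -tofracN -!tofracM -tofracD.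
  rewrite !frac_map_frac // !(rmorphD, rmorphM, rmorphN) /=.
  by rewrite -addf_div ?f0 // !mulNr.
have SM : monoid_morphism S.
  split=> //; elim/frac_ind=> p q q0; elim/frac_ind=> p' q' q'0.
  have qq0 : q * q' != 0 by rewrite mulf_neq0.
  rewrite mulf_div -!tofracM !frac_map_frac //.
  by rewrite !rmorphM mulf_div.
pose s1 := GRing.isZmodMorphism.Build _ _ S SB.
pose s2 := GRing.isMonoidMorphism.Build _ _ S SM.
pose s : {rmorphism {fraction A} -> K} := HB.pack S s1 s2.
by exists s.
Qed.

Lemma frac_map_poly p : S p%:F = f p.
Proof.
by have := frac_map_frac p (oner_neq0 A); rewrite !rmorph1 !divr1.
Qed.

End FractionMap.

Section Subst.
Variables (R : realType) (d : nat).
Local Notation C := (complex R).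
Local Notation P := (jetpoly R d).
Local Notation F := (jetfun R d).
Local Notation "p %:F" := (@FracField.tofrac P p).
Local Notation cX := (@cX R d).
Local Notation cst := (@cst R d).

Implicit Types (phi : Defs.coord d -> F) (x : Defs.coord d).
HB.instance Definition _ := GRing.RMorphism.copy cst
  (@FracField.tofrac P \o @mpolyC #|{: Defs.coord d}| C).
HB.instance Definition _ phi := GRing.RMorphism.copy (@msubst R d phi)
  (mmap cst (fun i => phi (enum_val i))).

Lemma msubstC phi c : msubst phi (c%:MP) = cst c.
Proof. exact: mmapC. Qed.

Lemma msubst_pX phi x : msubst phi (pX R x) = phi x.
Proof. by rewrite /msubst /pX mmapX mmap1U enum_rankK. Qed.

Lemma msubst_eq phi (g : {rmorphism P -> F}) :
  (forall c, g c%:MP = cst c) -> (forall x, g (pX R x) = phi x) -> msubst phi =1 g.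
Proof.
move=> gC gX p; apply: mpoly_rmorph_eq => [c|i]; first exact: etrans (msubstC _ _) (esym (gC c)).
by rewrite -(enum_valK i); apply: etrans (msubst_pX _ _) (esym (gX _)).
Qed.

Lemma msubst_cX p : msubst cX p = p%:F.
Proof. exact: msubst_eq. Qed.


Lemma fsubst_rmorph phi : injective (@msubst R d phi) ->
  exists s : {rmorphism F -> F}, fsubst phi =1 s.
Proof. by move=> inj; exact: (frac_map_rmorph inj). Qed.

Lemma fsubst_poly phi (p : P) : injective (@msubst R d phi) ->
  fsubst phi p%:F = msubst phi p.
Proof. by move=> inj; exact: (frac_map_poly inj). Qed.

(** A left inverse [psi] on the coordinates gives one on all polynomials, as morphisms are
    determined by constants and variables. It is applied to the inverse rescaling and the inverse
    change of parameter. *)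
Lemma msubst_tofrac_inj (phi psi : Defs.coord d -> P) :
    (forall x, msubst (fun y => (psi y)%:F) (phi x) = cX x) ->
  injective (@msubst R d (fun y => (phi y)%:F)).
Proof.
move=> psiK.
pose f : {rmorphism P -> P} := mmap (@mpolyC _ C) (fun i => phi (enum_val i)).
have fE p : msubst (fun y => (phi y)%:F) p = (f p)%:F.
  apply: (msubst_eq (g := @FracField.tofrac P \o f)) => [c|x] /=.
    by rewrite /f /= mmapC.
  by rewrite /f /= mmapX mmap1U enum_rankK.
have gf p : msubst (fun y => (psi y)%:F) (f p) = p%:F.
  rewrite -msubst_cX; symmetry.
  apply: (msubst_eq (g := @msubst R d (fun y => (psi y)%:F) \o f)) => [c|x] /=.
    by rewrite /f /= mmapC; apply: msubstC.
  by rewrite /f /= mmapX mmap1U enum_rankK.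
move=> p q; rewrite !fE => /tofrac_injective e.
by apply: tofrac_injective; rewrite -!gf e.
Qed.

End Subst.

(** * Regular functions *)

(** Quotient rule with cleared denominators: differentiate g s^N = a, then multiply by s^N. *)
Lemma der_clear (K : fieldType) (dl : K -> K) (g a s : K) N : derivation dl ->
  g * s ^+ N = a ->
  dl g * s ^+ (N + N) = dl a * s ^+ N - a * dl (s ^+ N).
Proof. by move=> dlP <-; rewrite (derM dlP) exprD; ring. Qed.

Section Localization.
Variables (A : comNzRingType) (K : fieldType) (f : {rmorphism A -> K}).

Definition localized (s g : K) : Prop := exists (N : nat) (p : A), g * s ^+ N = f p.

Lemma localized_mor s p : localized s (f p).
Proof. by exists 0%N, p; rewrite expr0 mulr1. Qed.

Lemma localizedM s g h : localized s g -> localized s h -> localized s (g * h).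
Proof.
move=> [N [p e]] [M [q e']]; exists (N + M)%N, (p * q).
by rewrite rmorphM -e -e' exprD mulrACA.
Qed.

Lemma localized1 s g : localized 1 g -> localized s g.
Proof. by move=> [N [p]]; rewrite expr1n mulr1 => ->; apply: localized_mor. Qed.

Variables (t : A) (s : K).
Hypotheses (sE : s = f t) (s0 : s != 0).

(** Passing to the common denominator s^(N + M) multiplies numerators by powers of [s], so [s]
    itself has to lie in the image of [f]. *)
Lemma localizedD g h : localized s g -> localized s h -> localized s (g + h).
Proof.
move=> [N [p e]] [M [q e']]; exists (N + M)%N, (p * t ^+ M + q * t ^+ N).
by rewrite rmorphD !rmorphM !rmorphXn -e -e' -sE exprD; ring.
Qed.

Lemma localizedV g : localized s (g * s) -> localized s g.
Proof. by move=> [N [p e]]; exists N.+1, p; rewrite exprS mulrA. Qed.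

End Localization.

Section Regular.
Variables (R : realType) (d : nat).
Local Notation C := (complex R).
Local Notation P := (jetpoly R d).
Local Notation F := (jetfun R d).
Local Notation "p %:F" := (@FracField.tofrac P p).
Local Notation cX := (@cX R d).
Local Notation cst := (@cst R d).
Local Notation D := (@D R d).

Lemma cX_neq0 x : cX x != 0.
Proof. by rewrite tofrac_eq0 -msize_poly_eq0 msizeX. Qed.

Section Closure.
Variables (phi : Defs.coord d -> F) (y : Defs.coord d).
Implicit Types (g h s : F).

Lemma regularP s g : regular phi s g <-> localized (@msubst R d phi) s g.
Proof. by []. Qed.

Lemma regular_msubst s p : regular phi s (msubst phi p).
Proof. by apply/regularP; apply: localized_mor. Qed.

Lemma regular_cst s c : regular phi s (cst c).
Proof. by rewrite -(msubstC phi); exact: regular_msubst. Qed.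

Lemma regular_nat s n : regular phi s n%:R.
Proof. by rewrite -(rmorph_nat (@msubst R d phi)); apply: regular_msubst. Qed.

Lemma regular0 s : regular phi s 0.
Proof. exact: (regular_nat _ 0). Qed.

Lemma regular1 s : regular phi s 1.
Proof. exact: (regular_nat _ 1). Qed.

Lemma regular_coord s x : regular phi s (phi x).
Proof. by rewrite -(msubst_pX phi); exact: regular_msubst. Qed.

Lemma regularM s g h : regular phi s g -> regular phi s h -> regular phi s (g * h).
Proof. by move=> /regularP rg /regularP rh; apply/regularP; apply: localizedM. Qed.

Lemma regularX s g n : regular phi s g -> regular phi s (g ^+ n).
Proof.
move=> rg; elim: n => [|n IH]; first by rewrite expr0; apply: regular1.
by rewrite exprS; apply: regularM.
Qed.

Lemma regular_loc s g : regular phi 1 g -> regular phi s g.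
Proof. by move=> /regularP rg; apply/regularP; apply: localized1. Qed.

Lemma regularN s g : regular phi s g -> regular phi s (- g).
Proof.
rewrite -mulN1r => rg; apply: regularM => //.
by rewrite -(rmorphN1 (@msubst R d phi)); apply: regular_msubst.
Qed.

(* The denominators that occur are products of coefficients, hence regular. *)
Variables (t : P) (s : F).
Hypothesis (sE : s = msubst phi t).

Lemma regularD g h : regular phi s g -> regular phi s h -> regular phi s (g + h).
Proof. move=> /regularP rg /regularP rh; apply/regularP; exact: localizedD sE _ _ rg rh. Qed.

Lemma regularB g h : regular phi s g -> regular phi s h -> regular phi s (g - h).
Proof. by move=> rg rh; apply: regularD => //; apply: regularN. Qed.

Lemma regular_sum (I : Type) (r : seq I) (Q : pred I) (g : I -> F) :
  (forall i, Q i -> regular phi s (g i)) -> regular phi s (\sum_(i <- r | Q i) g i).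
Proof. by move=> rg; elim/big_ind: _ => //; [exact: regular0|exact: regularD]. Qed.

Lemma regular_div g h : g * s = h -> regular phi s h -> regular phi s g.
Proof. move=> <- /regularP rg; apply/regularP; exact: localizedV rg. Qed.

End Closure.

Lemma D_cX x : D (cX x) = Dfield R x.
Proof. exact: lie_cX. Qed.

Lemma regular_poly s p : regular cX s p%:F.
Proof. by rewrite -msubst_cX; apply: regular_msubst. Qed.

(** The components of [Dfield] are polynomials, for z_3 too since z_3' = z_3 xi_3; hence only the
    denominator needs care, and [der_clear] bounds its exponent. *)
Lemma regular_D t s g : s = msubst cX t -> s != 0 ->
  regular cX s g -> regular cX s (D g).
Proof.
move=> sE s0 [N [p e]].
have rP q : regular cX s (D (msubst cX q)).
  rewrite msubst_cX; apply: (regular_sum sE) => x _.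
  apply: regularM; last by rewrite pd_poly; apply: regular_poly.
  case: x => -[k lk] [i|[[]|m]] /=.
  - by case: ifP => _; [apply: regular_coord|apply: regular0].
  - case: ifP => _; first by apply: regularM; apply: regular_coord.
    by case: ifP => _; [apply: regular_coord|apply: regular0].
  - by case: ifP => _; [apply: regular_coord|apply: regular0].
have rs : regular cX s (s ^+ N) by rewrite sE; apply: regularX; apply: regular_msubst.
have rDs : regular cX s (D (s ^+ N)).
  by rewrite sE -(rmorphXn (@msubst R d cX)); rewrite -sE; apply: rP.
have [M [q e']] : regular cX s (D (msubst cX p) * s ^+ N - msubst cX p * D (s ^+ N)).
  by apply: (regularB sE); apply: regularM => //; apply: regular_msubst.
exists (N + N + M)%N, q; rewrite -e' exprD mulrA; congr (_ * _).
by apply: (der_clear (D_derivation R d)).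
Qed.

Lemma acoef_neq0 m : acoef R m != 0 :> F.
Proof. exact: cX_neq0. Qed.

End Regular.

(** * Tangency of the acceleration field *)

Section Tangency.
Variables (A : idomainType) (K : fieldType) (e : {rmorphism A -> K}).
Variables (D dl : K -> K) (DP : derivation D) (dlP : derivation dl).

Lemma DDM x y : D (D (x * y)) = D (D x) * y + (D x * D y) *+ 2 + x * D (D y).
Proof. by rewrite (derM DP) (derD DP) !(derM DP) mulr2n; ring. Qed.

Definition killed x := [/\ dl x = 0, dl (D x) = 0 & dl (D (D x)) = 0].

Lemma killed1 : killed 1.
Proof. by split; rewrite ?(der1 DP) ?(der0 DP) ?(der1 dlP) ?(der0 dlP). Qed.

Lemma killedM x y : killed x -> killed y -> killed (x * y).
Proof.
move=> [x0 x1 x2] [y0 y1 y2]; split.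
- by rewrite (derM dlP) x0 y0; ring.
- by rewrite (derM DP) (derD dlP) !(derM dlP) x0 x1 y0 y1; ring.
- rewrite DDM mulr2n !(derD dlP) !(derM dlP) x0 x1 x2 y0 y1 y2; ring.
Qed.

Lemma killedX x n : killed x -> killed (x ^+ n).
Proof.
move=> Kx; elim: n => [|n IH]; first by rewrite expr0; apply: killed1.
by rewrite exprS; apply: killedM.
Qed.

Variables (z z1 z2 T : 'I_2 -> K).
Hypotheses (Dz : forall i, D (z i) = z1 i) (Dz1 : forall i, D (z1 i) = z2 i).
Hypotheses (dlz : forall i, dl (z i) = 0) (dlz1 : forall i, dl (z1 i) = 0).
Hypothesis (dlz2 : forall i, dl (z2 i) = T i).
Hypothesis two_neq0 : 2%:R != 0 :> K.

(* Modulo X^3, Taylor maps a polynomial in Y to the 2-jet of its value at z with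
   the coefficients held constant; being a ring morphism it encodes Leibniz' rule. *)
Definition taylor (i : 'I_2) : {poly K} := (z i)%:P + (z1 i)%:P * 'X + (z2 i / 2%:R)%:P * 'X^2.
Definition Taylor : {mpoly A[2]} -> {poly K} := mmap (polyC \o e) taylor.
HB.instance Definition _ := GRing.RMorphism.copy Taylor (mmap (polyC \o e) taylor).

Lemma Taylor_X m : Taylor 'X_[m] = \prod_i taylor i ^+ m i.
Proof. exact: mmapX. Qed.

Lemma TaylorC c : Taylor c%:MP = (e c)%:P.
Proof. exact: mmapC. Qed.

Lemma TaylorZ c p : Taylor (c *: p) = (e c)%:P * Taylor p.
Proof. by rewrite -mul_mpolyC rmorphM /= TaylorC. Qed.

(** Divided powers: the coefficient of X^2 is half the second derivative. *)
Definition jet_of (p : {poly K}) x :=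
  [/\ p`_0 = x, p`_1 = D x & p`_2 *+ 2 = D (D x)].

Lemma jet_of1 : jet_of 1 1.
Proof. by rewrite /jet_of !coef1 /= (der1 DP) (der0 DP) mul0rn. Qed.

Lemma jet_ofM p q x y : jet_of p x -> jet_of q y -> jet_of (p * q) (x * y).
Proof.
move=> [p0 p1 p2] [q0 q1 q2]; rewrite /jet_of DDM (derM DP) -p2 -q2 -p1 -q1 -p0 -q0.
rewrite !coefM !big_ord_recl !big_ord0 /= !subn0 /bump /= !addn0 ?subnn.
split; rewrite ?mulr2n; ring.
Qed.

Lemma jet_of_taylor i : jet_of (taylor i) (z i).
Proof.
rewrite /jet_of /taylor Dz Dz1 !coefD !coefCM !coefC !coefX !coefXn /=.
split; rewrite ?(mulr0, mulr1, addr0, add0r) //. by rewrite -[LHS]mulr_natr divfK.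
Qed.

Lemma jet_of_monomial m : jet_of (Taylor 'X_[m]) (\prod_i z i ^+ m i).
Proof.
rewrite Taylor_X.
have H i n : jet_of (taylor i ^+ n) (z i ^+ n).
  elim: n => [|n IH]; first by rewrite !expr0; apply: jet_of1.
  by rewrite !exprS; apply: jet_ofM => //; apply: jet_of_taylor.
by elim/big_ind2: _ => //; [apply: jet_of1|move=> *; apply: jet_ofM].
Qed.

(* The acceleration of z^m is T . grad; stated for products, hence the pairing of
   a polynomial p with its value x. *)
Definition acc (p : {mpoly A[2]}) x := [/\ (Taylor p)`_0 = x, dl x = 0, dl (D x) = 0 &
  dl (D (D x)) = \sum_i T i * (Taylor p^`M(i))`_0].

(** In D (D x) only the part linear in the z_i'' is moved, with the partial derivatives at z as
    coefficients. Both sides obey Leibniz' rule, so variables and products suffice. *)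
Lemma acc_monomial m : acc 'X_[m] (\prod_i z i ^+ m i).
Proof.
have acc1 : acc 1 1.
  split; rewrite ?rmorph1 ?coef1 ?(der1 DP) ?(der0 DP) ?(der1 dlP) ?(der0 dlP) //.
  by rewrite big1 // => i _; rewrite -(mpolyC1 _ A) mderivC rmorph0 coef0 mulr0.
have accM p q x y : acc p x -> acc q y -> acc (p * q) (x * y).
  move=> [p0 x0 x1 x2] [q0 y0 y1 y2]; split.
  - by rewrite rmorphM coef0M p0 q0.
  - by rewrite (derM dlP) x0 y0; ring.
  - by rewrite (derM DP) (derD dlP) !(derM dlP) x0 x1 y0 y1; ring.
  - rewrite DDM mulr2n !(derD dlP) !(derM dlP) x0 x1 x2 y0 y1 y2.
    rewrite !mulr0 !mul0r !addr0 !add0r mulr_suml mulr_sumr -big_split.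
    apply: eq_bigr => i _; rewrite mderivM rmorphD !rmorphM coefD !coef0M /= p0 q0.
    ring.
have accX i : acc 'X_i (z i).
  split; rewrite ?Dz ?Dz1 ?dlz ?dlz1 ?dlz2 //.
    have [<- _ _] := jet_of_taylor i; congr (_`__).
    by rewrite /Taylor mmapX mmap1U.
  rewrite (bigD1 i) //= big1 ?addr0 => [|j /negPf ji]; rewrite mderivX mnm1E.
    by rewrite eqxx scale1r -{1}(add0m U_(_)%MM) addmK mpolyX0 rmorph1 coef1 mulr1.
  by rewrite eq_sym ji scale0r rmorph0 coef0 mulr0.
have H i n : acc ('X_i ^+ n) (z i ^+ n).
  by elim: n => [|n IH]; rewrite ?expr0 // !exprS; apply: accM.
rewrite mpolyXE_id; elim/big_ind2: _ => //.
by move=> p x q y; apply: accM.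
Qed.

Variables (zA : 'I_2 -> A) (zAE : forall i, e (zA i) = z i).

Lemma Taylor_XB i :
  Taylor ('X_i - (zA i)%:MP) = 'X * ((z1 i)%:P + (z2 i / 2%:R)%:P * 'X).
Proof.
rewrite rmorphB /= TaylorC /= zAE {1}/Taylor mmapX mmap1U /taylor.
by rewrite expr2; ring.
Qed.

(** Each factor Y_i - z_i vanishes at the source point and contributes one power of X. With |gamma|
    = 3 the correction leaves the 2-jet alone. *)
Lemma Taylor_prodXB (m : 'X_{1..2}) q n : mdeg m = n -> exists w,
  Taylor ((\prod_i ('X_i - (zA i)%:MP) ^+ m i) * q) = 'X^n * w.
Proof.
move=> <-; rewrite rmorphM rmorph_prod /=.
under eq_bigr do rewrite rmorphXn /= Taylor_XB exprMn.
by rewrite big_split prodrXr -mdegE -mulrA /=; eexists.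
Qed.

Lemma Taylor_sum_multiple n (I : eqType) (l : seq I) (B : pred I) (b : I -> A) p :
    (forall i, i \in l -> B i -> exists w, Taylor (p i) = 'X^n * w) ->
  exists w, Taylor (\sum_(i <- l | B i) b i *: p i) = 'X^n * w.
Proof.
move=> pX; rewrite big_seq_cond.
elim/big_ind: _ => [|x y [w wE] [w' wE']|i /andP[il Bi]].
- by exists 0; rewrite rmorph0 mulr0.
- by exists (w + w'); rewrite rmorphD /= wE wE' mulrDr.
- have [w wE] := pX i il Bi.
  by exists ((e (b i))%:P * w); rewrite TaylorZ wE mulrCA.
Qed.

Variables (d : nat) (a : 'X_{1..2 < d.+1} -> A) (r : K) (tau beta : 'I_2 -> A).
Let f : {mpoly A[2]} := \sum_m a m *: 'X_[m].
Variables (c : A) (Q Qc : {mpoly A[2]}).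
Hypothesis TE : forall i, T i = e (tau i) * (\sum_j e (beta j) * z1 j) ^+ 2.
Hypothesis cE : e c = - 2%:R^-1.
Hypothesis QE : Q = c *: ((\sum_i tau i *: f^`M(i))
   * (\sum_i beta i *: ('X_i - (zA i)%:MP)) ^+ 2) - Qc.
Hypothesis Qc3 : exists w, Taylor Qc = 'X^3 * w.
Hypothesis Qsize : (msize Q <= d.+1)%N.
Hypothesis rK : killed r.
Hypotheses (dla : forall m, dl (e (a m)) = e Q@_m)
  (dla1 : forall m, dl (D (e (a m))) = 0)
  (dla2 : forall m, dl (D (D (e (a m)))) = 0).

Let xi := \sum_j e (beta j) * z1 j.
Let grad := (Taylor (\sum_i tau i *: f^`M(i)))`_0.

(** The square of beta . (Y - z) supplies X^2, so only the values at the source point of the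
    gradient and of the velocity enter that coefficient; [Qc] starts at X^3. *)
Lemma Taylor_Q : exists w,
  Taylor Q = 'X^2 * ((- 2%:R^-1 * grad * xi ^+ 2)%:P + 'X * w).
Proof.
have [w ->] : exists w, Taylor Q = 'X^2 *
    ((- 2%:R^-1)%:P * Taylor (\sum_i tau i *: f^`M(i)) * (xi%:P + 'X * w) ^+ 2)
    - Taylor Qc.
  pose w := \sum_i (e (beta i) * (z2 i / 2%:R))%:P.
  exists w; rewrite QE rmorphB /= TaylorZ rmorphM rmorphXn /= cE.
  set t := Taylor _; have -> : Taylor (\sum_i beta i *: ('X_i - (zA i)%:MP))
    = 'X * (xi%:P + 'X * w).
    rewrite [LHS]rmorph_sum /= /xi /w (rmorph_sum polyC) /= !mulr_sumr.
    rewrite -big_split mulr_sumr; apply: eq_bigr => i _.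
    by rewrite TaylorZ Taylor_XB !polyCM /=; ring.
  by rewrite exprMn; ring.
have [w' ->] := Qc3.
have [t tE] : exists t, Taylor (\sum_i tau i *: f^`M(i)) = grad%:P + 'X * t.
  rewrite /grad; set p := Taylor _.
  (* The quotient by X: coefficients shifted down by one. *)
  exists (\poly_(i < (size p).-1) p`_i.+1); apply/polyP => i.
  rewrite coefD coefC coefXM coef_poly; case: i => [|i] /=; first by rewrite addr0.
  rewrite add0r; case: ltnP => // le; rewrite nth_default //.
  by move: le; case: (size p).
exists ((- 2%:R^-1)%:P * (t * (xi%:P + 'X * w) ^+ 2
   + grad%:P * (xi%:P * w *+ 2 + 'X * w ^+ 2)) - w').
by rewrite tE !polyCM; ring.
Qed.

(** The degree bound enters here: every monomial of [Q] has a coefficient a_m that can be moved. *)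
Lemma coef_Taylor_Q k :
  (Taylor Q)`_k = \sum_(m : 'X_{1..2 < d.+1}) e Q@_m * (Taylor 'X_[m])`_k.
Proof.
rewrite {1}(mpolywE Qsize) rmorph_sum coef_sum; apply: eq_bigr => m _ /=.
by rewrite TaylorZ coefCM.
Qed.

Let E := r + \sum_m e (a m) * \prod_i z i ^+ m i.

(** Since [dl] moves a_m by the coefficient of [Q] and kills the derivatives of a_m, its value on
    D^j E is j! times the j-th Taylor coefficient of [Q]; for j = 2 the acceleration of z is
    added. *)
Lemma accel_kills_equation : killed E.
Proof.
have [w Qw] := Taylor_Q; have [r0 r1 r2] := rK.
split; rewrite ?(derD DP, derD dlP) ?r0 ?r1 ?r2 add0r.
- rewrite (der_sum dlP).
  have : (Taylor Q)`_0 = 0 by rewrite Qw coefXnM.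
  rewrite coef_Taylor_Q => q0; rewrite -[RHS]q0; apply: eq_bigr => m _.
  have [x0 x1 x2 x3] := acc_monomial m; have [<- _ _] := jet_of_monomial m.
  by rewrite (derM dlP) dla x0 x1; ring.
- rewrite (der_sum DP) (der_sum dlP).
  have : (Taylor Q)`_1 = 0 by rewrite Qw coefXnM.
  rewrite coef_Taylor_Q => q0; rewrite -[RHS]q0; apply: eq_bigr => m _.
  have [x0 x1 x2 x3] := acc_monomial m; have [_ -> _] := jet_of_monomial m.
  by rewrite (derM DP) (derD dlP) !(derM dlP) dla dla1 x1 x2; ring.
- rewrite !(der_sum DP) (der_sum dlP).
  (* The factor 2! cancels the 1/2 in the constant [c] and leaves minus the acceleration term. *)
  have Q2 : (Taylor Q)`_2 *+ 2 = - (grad * xi ^+ 2).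
    rewrite Qw coefXnM /= coefD coefC coefXM /= addr0 mulNr mulNr mulNrn.
    by rewrite -mulrA -[X in - X]mulr_natl mulVKf.
  have : (Taylor Q)`_2 *+ 2 + grad * xi ^+ 2 = 0 by rewrite Q2 addNr.
  move=> q0; rewrite -[RHS]q0 coef_Taylor_Q /grad rmorph_sum coef_sum /=.
  (* By linearity of the derivative, (tau . df) (beta . xi)^2 at z becomes a sum of a_m times the
     acceleration of z^m, the form given by [acc_monomial]. *)
  have -> : (\sum_i (Taylor (tau i *: f^`M(i)))`_0) * xi ^+ 2
    = \sum_m e (a m) * \sum_i T i * (Taylor ('X_[m])^`M(i))`_0.
    rewrite mulr_suml; under [RHS]eq_bigr do rewrite mulr_sumr.
    rewrite exchange_big; apply: eq_bigr => i _ /=.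
    rewrite TaylorZ coefCM /f !linear_sum /= rmorph_sum coef_sum mulr_sumr mulr_suml.
    apply: eq_bigr => m _; rewrite linearZ /= TaylorZ coefCM TE -/xi; ring.
  rewrite -sumrMnl -big_split; apply: eq_bigr => m _ /=.
  have [x0 x1 x2 x3] := acc_monomial m; have [_ _ y2] := jet_of_monomial m.
  rewrite DDM !(derD dlP) !(derM dlP) dla dla1 dla2 x1 x2 x3.
  by rewrite -y2 mulr2n; ring.
Qed.

End Tangency.

(** * Behaviour under changes of parameter *)

Section Covariance.
Variables (K : fieldType) (D : K -> K) (DP : derivation D) (s : {rmorphism K -> K}).
Variables (b1 b2 : K).

(** The chain rule for a change of parameter fixing the source point, with first and second
    derivatives [b1] and [b2]. *)
Definition covariant x := [/\ s x = x, s (D x) = b1 * D x &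
  s (D (D x)) = b1 ^+ 2 * D (D x) + b2 * D x].

Lemma covariantD x y : covariant x -> covariant y -> covariant (x + y).
Proof.
move=> [x0 x1 x2] [y0 y1 y2]; rewrite /covariant !(derD DP) !rmorphD.
by rewrite x0 x1 x2 y0 y1 y2; split=> //; ring.
Qed.

Lemma covariantM x y : covariant x -> covariant y -> covariant (x * y).
Proof.
move=> [x0 x1 x2] [y0 y1 y2]; rewrite /covariant (DDM DP) (derM DP) mulr2n.
rewrite !rmorphD !rmorphM /= x0 x1 x2 y0 y1 y2; split=> //; ring.
Qed.

Lemma covariantV x : covariant x -> covariant x^-1.
Proof.
have [->|x0] := eqVneq x 0; first by rewrite invr0.
move=> [s0 s1 s2].
have D1 : D x^-1 = - D x / (x * x) by rewrite (derV DP) // expr2.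
have D2 : D (D x^-1) = (D x * D x + D x * D x - x * D (D x)) / (x * x * x).
  rewrite D1 (der_div DP) ?mulf_neq0 // (derN DP) (derM DP).
  by field.
rewrite /covariant D2 D1 !(rmorphM, rmorphN, rmorphD, fmorphV) /= s0 s1 s2.
by split=> //; field.
Qed.

End Covariance.

(** * Weights and poles at infinity *)

Section Weights.
Variables (R : realType) (d : nat).
Local Notation C := (complex R).
Local Notation P := (jetpoly R d).
Local Notation F := (jetfun R d).
Local Notation "p %:F" := (@FracField.tofrac P p).
Local Notation cX := (@cX R d).
Local Notation cst := (@cst R d).
Local Notation D := (@D R d).
Local Notation base := (Defs.base d).
Local Notation coord := (Defs.coord d).
Local Notation hom := (@Defs.hom R d).
Local Notation chart := (@chart R d).
Implicit Types (phi : coord -> F) (x : coord) (g h : F).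

Lemma ord3P (Q : 'I_3 -> Prop) : Q k0 -> Q k1 -> Q k2 -> forall k, Q k.
Proof.
move=> q0 q1 q2 [[|[|[|n]]] lt] //.
- by move: q0; congr (Q _); apply: val_inj.
- by move: q1; congr (Q _); apply: val_inj.
- by move: q2; congr (Q _); apply: val_inj.
Qed.

Lemma inord1 : inord 1 = k1 :> 'I_3. Proof. by apply: val_inj; rewrite /= inordK. Qed.
Lemma inord2 : inord 2 = k2 :> 'I_3. Proof. by apply: val_inj; rewrite /= inordK. Qed.

Lemma D_z i : (D (cX (zc k0 i)) = cX (zc k1 i)) * (D (cX (zc k1 i)) = cX (zc k2 i)).
Proof. by rewrite !D_cX /= inord1 inord2. Qed.

Lemma D_a m : (D (cX (ac k0 m)) = cX (ac k1 m)) * (D (cX (ac k1 m)) = cX (ac k2 m)).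
Proof. by rewrite !D_cX /= inord1 inord2. Qed.

Lemma D_r : (D (cX (rc k0)) = cX (rc k0) * cX (rc k1)) * (D (cX (rc k1)) = cX (rc k2)).
Proof. by rewrite !D_cX. Qed.

Lemma cstZ phi c p : msubst phi (c *: p) = cst c * msubst phi p.
Proof. by rewrite -mul_mpolyC rmorphM /= msubstC. Qed.

Lemma cst_neq0 c : c != 0 -> cst c != 0.
Proof. by move=> c0; rewrite tofrac_eq0 mpolyC_eq0. Qed.

Lemma tofracZ c p : (c *: p)%:F = cst c * p%:F.
Proof. by rewrite -mul_mpolyC rmorphM. Qed.

Lemma rescale_inj mu : mu != 0 -> injective (@msubst R d (fun y => (rescale mu y)%:F)).
Proof.
move=> mu0; apply: (@msubst_tofrac_inj _ _ _ (rescale mu^-1)) => x.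
have H c : c != 0 -> cst c * (cst c^-1 * cX x) = cX x.
  by move=> c0; rewrite mulrA -rmorphM divff // rmorph1 mul1r.
case: x H => k [i|[[]|m]] H /=; rewrite ?msubst_pX //.
- by case: ifP => k0; rewrite ?cstZ msubst_pX /= k0 ?tofracZ ?H.
- by rewrite cstZ msubst_pX /= tofracZ exprVn H ?expf_neq0.
Qed.

Lemma reparam_inj (b1 b2 : C) : b1 != 0 ->
  injective (@msubst R d (fun y => (reparam b1 b2 y)%:F)).
Proof.
(* The inverse change of parameter has derivatives 1 / b1 and - b2 / b1^3. *)
move=> b0; apply: (@msubst_tofrac_inj _ _ _ (reparam b1^-1 (- b2 / b1 ^+ 3))) => -[k b].
elim/ord3P: k; rewrite /reparam /= ?msubst_pX //.
- rewrite cstZ msubst_pX /= tofracZ mulrA -rmorphM divff // rmorph1 mul1r //.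
- rewrite rmorphD /= !cstZ !msubst_pX /= rmorphD /= !tofracZ /=.
  rewrite mulrDr !mulrA -!rmorphM -addrA -mulrDl -rmorphD /=.
  have -> : b1 ^+ 2 * (b1^-1) ^+ 2 = 1 by field.
  have -> : b1 ^+ 2 * (- b2 / b1 ^+ 3) + b2 * b1^-1 = 0 by field.
  by rewrite rmorph1 rmorph0 mul1r mul0r addr0.
Qed.

Lemma hom0 : hom ord0 = 1.
Proof. by rewrite /Defs.hom unlift_none. Qed.

Lemma hom_lift j : hom (lift ord0 j) = cX (zc k0 j).
Proof. by rewrite /Defs.hom liftK. Qed.

Lemma hom_neq0 i : hom i != 0.
Proof.
case: (unliftP ord0 i) => [j|] ->; first by rewrite hom_lift cX_neq0.
by rewrite hom0 oner_neq0.
Qed.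

Lemma regular_ratio i j s k : (k < 3)%N -> regular (chart i) s (iter k D (hom j / hom i)).
Proof.
move=> k3; case: (unliftP i j) => [l|] ->; first exact: (regular_coord _ _ (zc (Ordinal k3) l)).
rewrite divff ?hom_neq0 //; case: k {k3} => [|k]; first exact: regular1.
rewrite iterSr (der1 (D_derivation R d)).
have -> : iter k D 0 = 0.
  by elim: k => //= k ->; apply: (der0 (D_derivation R d)).
exact: regular0.
Qed.

(* Functions of (z, a) with a pole of order at most e at infinity and of weight w
   under rescaling (a has weight d). *)
Record weight (e w : nat) (g : F) : Prop := Weight {
  weight_order0 : order0 g;
  weight_rescale : forall mu : C, mu != 0 ->
    fsubst (fun y => (rescale mu y)%:F) g = cst mu ^+ w * g;
  weight_covariant : forall (b1 b2 : C) (s : {rmorphism F -> F}), b1 != 0 ->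
    fsubst (fun y => (reparam b1 b2 y)%:F) =1 s -> covariant D s (cst b1) (cst b2) g;
  weight_pole : forall i, regular (chart i) 1 ((hom ord0 / hom i) ^+ e * g) }.

Lemma order0D g h : order0 g -> order0 h -> order0 (g + h).
Proof. by move=> og oh k b k_gt0; rewrite (derD (@pd_derivation R d _)) og // oh // addr0. Qed.

Lemma order0M g h : order0 g -> order0 h -> order0 (g * h).
Proof.
by move=> og oh k b k_gt0; rewrite (derM (@pd_derivation R d _)) og // oh // mul0r mulr0 addr0.
Qed.

Lemma order0V g : order0 g -> order0 g^-1.
Proof.
have [->|g0] := eqVneq g 0; first by rewrite invr0.
by move=> og k b k_gt0; rewrite (derV (@pd_derivation R d _)) // og // oppr0 mul0r.
Qed.

Lemma order0N g : order0 g -> order0 (- g).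
Proof. by move=> og k b k_gt0; rewrite (derN (@pd_derivation R d _)) og // oppr0. Qed.

Lemma order0_cst c : order0 (cst c).
Proof. by move=> k b _; apply: pd_cst. Qed.

Lemma order0_cX b : order0 (cX (k0, b)).
Proof.
move=> k b' k_gt0; rewrite pd_cX; have /negPf -> // : (k, b') != (k0, b).
by apply: contraTneq k_gt0 => /(congr1 fst) /= ->.
Qed.

Lemma msubst1E phi : 1 = msubst phi 1. Proof. by rewrite rmorph1. Qed.

Lemma weightD e w g h : weight e w g -> weight e w h -> weight e w (g + h).
Proof.
move=> [g1 g2 g3 g4] [h1 h2 h3 h4]; split.
- exact: order0D.
- move=> mu mu0; have [s sE] := fsubst_rmorph (rescale_inj mu0).
  by rewrite sE rmorphD -!sE g2 // h2 // mulrDr.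
- by move=> b1 b2 s b0 sE; apply: covariantD; [exact: D_derivation|apply: g3|apply: h3].
- by move=> i; rewrite mulrDr; apply: (regularD (msubst1E _)).
Qed.

Lemma weightM e w e' w' g h :
  weight e w g -> weight e' w' h -> weight (e + e') (w + w') (g * h).
Proof.
move=> [g1 g2 g3 g4] [h1 h2 h3 h4]; split.
- exact: order0M.
- move=> mu mu0; have [s sE] := fsubst_rmorph (rescale_inj mu0).
  by rewrite sE rmorphM -!sE g2 // h2 // exprD mulrACA.
- by move=> b1 b2 s b0 sE; apply: covariantM; [exact: D_derivation|apply: g3|apply: h3].
- by move=> i; rewrite exprD mulrACA; apply: regularM.
Qed.

Lemma weight_cst c : weight 0 0 (cst c).
Proof.
split.
- exact: order0_cst.
- by move=> mu mu0; rewrite fsubst_poly ?msubstC ?mul1r //; apply: rescale_inj.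
- move=> b1 b2 s b0 sE; have D0 : D (cst c) = 0 by apply: lie_cst.
  rewrite /covariant D0 (der0 (D_derivation R d)) rmorph0 !mulr0 addr0; split=> //.
  by rewrite -sE fsubst_poly ?msubstC //; apply: reparam_inj.
- by move=> i; rewrite mul1r; apply: regular_cst.
Qed.

Lemma weight_le e e' w g : (e <= e')%N -> weight e w g -> weight e' w g.
Proof.
move=> /subnK <- [g1 g2 g3 g4]; split=> // i.
rewrite exprD -mulrA; apply: regularM => //; apply: regularX.
exact: (regular_ratio i ord0 1 (k := 0)).
Qed.

Lemma weight0 e w : weight e w 0.
Proof.
split.
- by move=> k b _; rewrite (der0 (@pd_derivation R d _)).
- move=> mu mu0; have [s sE] := fsubst_rmorph (rescale_inj mu0).
  by rewrite sE rmorph0 mulr0.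
- move=> b1 b2 s b0 sE; rewrite /covariant !(der0 (D_derivation R d)) rmorph0.
  by rewrite !mulr0 addr0.
- by move=> i; rewrite mulr0; apply: regular0.
Qed.

Lemma weight_sum e w (I : Type) (r : seq I) (Q : pred I) (g : I -> F) :
  (forall i, Q i -> weight e w (g i)) -> weight e w (\sum_(i <- r | Q i) g i).
Proof. by move=> wg; elim/big_ind: _ => //; [exact: weight0|exact: weightD]. Qed.

Lemma covariant_base (b1 b2 : C) (s : {rmorphism F -> F}) b : b1 != 0 ->
  fsubst (fun y => (reparam b1 b2 y)%:F) =1 s ->
  covariant D s (cst b1) (cst b2) (cX (k0, b)).
Proof.
move=> b0 sE.
have sX x : s (cX x) = (reparam b1 b2 x)%:F.
  by rewrite -sE fsubst_poly ?msubst_pX //; apply: reparam_inj.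
rewrite /covariant; case: b => [i|[[]|m]].
- rewrite !D_z !sX /reparam /= rmorphD /= !tofracZ; split=> //.
  by rewrite rmorphXn.
(* Logarithmic jets obey the same chain rule as ordinary ones; Leibniz' rule on z_3' = z_3 xi_3
   transfers it to the derivatives of z_3. *)
- rewrite D_r (derM (D_derivation R d)) !D_r !(rmorphD, rmorphM) /= !sX /reparam /=.
  by rewrite rmorphD /= !tofracZ rmorphXn /= /Defs.cX; split=> //; ring.
- rewrite !D_a !sX /reparam /= rmorphD /= !tofracZ; split=> //.
  by rewrite rmorphXn.
Qed.

Lemma weight_z i : weight 1 0 (cX (zc k0 i)).
Proof.
split.
- exact: order0_cX.
- move=> mu mu0; rewrite fsubst_poly ?msubst_pX ?mul1r //.
  exact: rescale_inj.
- by move=> b1 b2 s; apply: covariant_base.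
- move=> j; rewrite hom0 div1r mulrC expr1 -hom_lift.
  exact: (regular_ratio j (lift ord0 i) 1 (k := 0)).
Qed.

Lemma weight_a m : weight 0 d (cX (ac k0 m)).
Proof.
split.
- exact: order0_cX.
- move=> mu mu0; rewrite fsubst_poly ?msubst_pX /= ?tofracZ ?rmorphXn //.
  exact: rescale_inj.
- by move=> b1 b2 s; apply: covariant_base.
- by move=> j; rewrite mul1r; apply: (regular_coord _ _ (ac k0 m)).
Qed.

End Weights.

(** * Degree of the parameter polynomial *)

Section Degree.
Variables (n : nat) (A : comNzRingType).
Implicit Types (p q : {mpoly A[n]}) (m : 'X_{1..n}).

Definition deg_lt k p := forall m, (k <= mdeg m)%N -> p@_m = 0.

Lemma deg_ltW k l p : (k <= l)%N -> deg_lt k p -> deg_lt l p.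
Proof. by move=> kl pk m lm; apply: pk; apply: leq_trans lm. Qed.

Lemma deg_ltD k p q : deg_lt k p -> deg_lt k q -> deg_lt k (p + q).
Proof. by move=> pk qk m km; rewrite mcoeffD pk // qk // addr0. Qed.

Lemma deg_ltM k l p q : deg_lt k.+1 p -> deg_lt l q -> deg_lt (k + l) (p * q).
Proof.
move=> pk ql m klm; rewrite mcoeffM big1 // => -[m1 m2] /= /eqP mE.
have [km1|m1k] := leqP k.+1 (mdeg m1); first by rewrite pk // mul0r.
by rewrite ql ?mulr0 //; move: (congr1 mdeg mE); rewrite mdegD; lia.
Qed.

Lemma deg_ltX m : deg_lt (mdeg m).+1 ('X_[m] : {mpoly A[n]}).
Proof. by move=> m' lt; rewrite mcoeffX; case: eqP => // e; rewrite e ltnn in lt. Qed.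

Lemma deg_lt_msize k p : deg_lt k p -> (msize p <= k)%N.
Proof.
move=> pk; rewrite msizeE; apply/bigmax_leqP_seq => m mp _; rewrite ltnNge.
by apply: contraL mp => /pk e; rewrite mcoeff_msupp e eqxx.
Qed.

Definition leading m p := deg_lt (mdeg m) (p - 'X_[m]).

Lemma leading_deg m p : leading m p -> deg_lt (mdeg m).+1 p.
Proof.
move=> pm; rewrite -(subrK 'X_[m] p); apply: deg_ltD; last exact: deg_ltX.
exact: deg_ltW pm.
Qed.

Lemma leadingX m : leading m 'X_[m].
Proof. by rewrite /leading subrr => m' _; rewrite mcoeff0. Qed.

Lemma leadingM m l p q : leading m p -> leading l q -> leading (m + l) (p * q).
Proof.
move=> pm ql; rewrite /leading mpolyXD mdegD.
have -> : p * q - 'X_[m] * 'X_[l] = q * (p - 'X_[m]) + 'X_[m] * (q - 'X_[l]) by ring.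
apply: deg_ltD; last by apply: deg_ltM => //; exact: deg_ltX.
by rewrite addnC; apply: deg_ltM => //; apply: leading_deg.
Qed.

Lemma leading_prodXB (c : 'I_n -> A) m : leading m (\prod_i ('X_i - (c i)%:MP) ^+ m i).
Proof.
have l0 : leading 0%MM (1 : {mpoly A[n]}) by rewrite -mpolyX0; apply: leadingX.
have lX i k : leading (U_(i) *+ k)%MM (('X_i - (c i)%:MP) ^+ k).
  elim: k => [|k IH]; first by rewrite mulm0n expr0.
  rewrite mulmS exprS; apply: leadingM => // m'; rewrite mdeg1 => m'0.
  rewrite addrAC subrr add0r mcoeffN mcoeffC.
  by case: eqP m'0 => [->|]; rewrite ?mdeg0 // mulr0 oppr0.
rewrite {1}(multinomUE_id m); elim/big_ind2: _ => // *; exact: leadingM.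
Qed.

(** The terms with |m| = k form the whole top part of [p], and each [L m] differs from X^m only
    below degree k. *)
Lemma deg_lt_sub_leading k p (L : 'X_{1..n} -> {mpoly A[n]}) : deg_lt k.+1 p ->
    (forall m, m \in msupp p -> mdeg m = k -> leading m (L m)) ->
  deg_lt k (p - \sum_(m <- msupp p | mdeg m == k) p@_m *: L m).
Proof.
move=> pk HL m km; rewrite mcoeffB raddf_sum /=.
rewrite [in X in X - _](mpolyE p) raddf_sum /=.
rewrite (bigID (fun m' : 'X_{1..n} => mdeg m' == k)) /= addrAC -sumrB.
rewrite big_seq_cond big1 ?add0r => [|m' /andP[m'Q /eqP m'd]].
  rewrite big_seq_cond big1 // => m' /andP[m'Q m'd]; rewrite mcoeffZ mcoeffX.
  case: eqP => [e|_]; last by rewrite mulr0.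
  by rewrite mulr1 e pk // ltn_neqAle eq_sym -{1}e m'd km.
rewrite !mcoeffZ -mulrBr -mcoeffB -opprB mcoeffN (HL _ m'Q m'd) ?m'd //.
by rewrite oppr0 mulr0.
Qed.

End Degree.

Section ParameterPolynomial.
Variables (R : realType) (d : nat).
Local Notation C := (complex R).
Local Notation P := (jetpoly R d).
Local Notation F := (jetfun R d).
Local Notation "p %:F" := (@FracField.tofrac P p).
Local Notation cst := (@cst R d).
Implicit Types (p q : {mpoly P[2]}) (m : 'X_{1..2}).

(* Total degree at most N in (Y, z), degree at most e in z, weight w in a. *)
Definition bidegree (N e w : nat) p := deg_lt N.+1 p /\
  forall m, weight (minn e (N - mdeg m)) w (p@_m)%:F.

Lemma bidegree_le N e w N' e' p : (N <= N')%N -> (e <= e')%N ->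
  bidegree N e w p -> bidegree N' e' w p.
Proof.
move=> NN ee [Np pw]; split; first exact: deg_ltW Np.
by move=> m; apply: weight_le (pw m); lia.
Qed.

Lemma bidegreeD N e w p q : bidegree N e w p -> bidegree N e w q ->
  bidegree N e w (p + q).
Proof.
move=> [Np pw] [Nq qw]; split; first exact: deg_ltD.
by move=> m; rewrite mcoeffD rmorphD; apply: weightD.
Qed.

Lemma bidegreeN N e w p : bidegree N e w p -> bidegree N e w (- p).
Proof.
move=> [Np pw]; split=> m; first by move=> Nm; rewrite mcoeffN Np // oppr0.
rewrite mcoeffN -mulN1r rmorphM -(add0n w) -(add0n (minn _ _)).
by apply: weightM (pw m); rewrite rmorphN1 -(rmorphN1 cst); apply: weight_cst.
Qed.

Lemma bidegree0 N e w : bidegree N e w 0.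
Proof. by split=> m; rewrite mcoeff0 ?rmorph0 //; apply: weight0. Qed.

Lemma bidegree_sum N e w (I : Type) (r : seq I) (Q : pred I) (g : I -> {mpoly P[2]}) :
  (forall i, Q i -> bidegree N e w (g i)) -> bidegree N e w (\sum_(i <- r | Q i) g i).
Proof. by move=> wg; elim/big_ind: _ => //; [exact: bidegree0|exact: bidegreeD]. Qed.

Lemma bidegreeM N e w N' e' w' p q : bidegree N e w p -> bidegree N' e' w' q ->
  bidegree (N + N') (e + e') (w + w') (p * q).
Proof.
move=> [Np pw] [Nq qw]; split; first by rewrite -addnS; apply: deg_ltM.
move=> m; rewrite mcoeffM rmorph_sum; apply: weight_sum => -[m1 m2] /= /eqP mE.
(* Subtraction of naturals truncates at 0, so the exponents add up only if |m1| <= N and |m2| <= N';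
   the other terms vanish. *)
have [N1|N1] := ltnP N (mdeg m1); first by rewrite Np // mul0r rmorph0; apply: weight0.
have [N2|N2] := ltnP N' (mdeg m2); first by rewrite Nq // mulr0 rmorph0; apply: weight0.
rewrite rmorphM; apply: weight_le (weightM (pw m1) (qw m2)).
by move: (congr1 mdeg mE); rewrite mdegD; lia.
Qed.

Lemma bidegreeC e w (c : P) : weight e w c%:F -> bidegree e e w c%:MP.
Proof.
move=> cw; split=> m; rewrite mcoeffC.
  by case: eqP => [->|]; rewrite ?mdeg0 // mulr0.
case: eqP => [->|_]; last by rewrite mulr0 rmorph0; apply: weight0.
by rewrite mulr1 mdeg0 subn0 minnn.
Qed.

Lemma bidegreeZ N e' e w w' (c : P) p : weight e' w' c%:F -> bidegree N e w p ->
  bidegree (e' + N) (e' + e) (w' + w) (c *: p).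
Proof. by move=> cw pN; rewrite -mul_mpolyC; apply: bidegreeM => //; apply: bidegreeC. Qed.

Lemma bidegreeXm m : bidegree (mdeg m) 0 0 'X_[m].
Proof.
split; first exact: deg_ltX.
move=> m'; rewrite mcoeffX min0n.
case: eqP => _; last by rewrite rmorph0; apply: weight0.
by rewrite rmorph1 -(rmorph1 cst); apply: weight_cst.
Qed.

Lemma bidegree1 : bidegree 0 0 0 1.
Proof. by have := bidegreeXm 0%MM; rewrite mdeg0 mpolyX0. Qed.

Lemma bidegreeX N e p k : bidegree N e 0 p -> bidegree (k * N) (k * e) 0 (p ^+ k).
Proof.
move=> pN; elim: k => [|k IH]; first by rewrite expr0; apply: bidegree1.
by rewrite exprS !mulSn; apply: (@bidegreeM _ _ 0 _ _ 0).
Qed.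

Lemma weightMn e w (g : F) k : weight e w g -> weight e w (g *+ k).
Proof.
move=> wg; elim: k => [|k IH]; first by rewrite mulr0n; apply: weight0.
by rewrite mulrS; apply: weightD.
Qed.

Lemma bidegree_deriv N e w p i : bidegree N e w p -> bidegree N.-1 e w p^`M(i).
Proof.
have D1 m : mdeg (m + U_(i)) = (mdeg m).+1 by rewrite mdegD mdeg1 addn1.
move=> [Np pw]; split=> m.
  by move=> Nm; rewrite mcoeff_deriv Np ?mul0rn // D1; lia.
rewrite mcoeff_deriv rmorphMn /=; apply: weightMn; apply: weight_le (pw _).
by rewrite D1; lia.
Qed.

Variables (tau beta : 'rV[C]_2) (gamma : 'X_{1..2} -> 'X_{1..2}).
Local Notation fY := (@fY R d).
Local Notation Yz := (@Yz R d).
Local Notation Q0 := (@Q0 R d tau beta).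
Local Notation Qlog := (@Qlog R d tau beta gamma).

Lemma weight_const (c : C) : weight 0 0 (c%:MP : P)%:F.
Proof. exact: weight_cst. Qed.

Lemma bidegree_fY : bidegree d 0 d fY.
Proof.
apply: bidegree_sum => m _.
have := bidegreeZ (weight_a R m) (bidegreeXm m); rewrite !addn0 !add0n.
by apply: bidegree_le => //; rewrite -ltnS bmdeg.
Qed.

Lemma bidegree_Yz i : bidegree 1 1 0 (Yz i).
Proof.
apply: bidegreeD.
  by apply: (bidegree_le _ _ (bidegreeXm U_(i))); rewrite ?mdeg1.
by apply: bidegreeN; apply: bidegreeC; apply: weight_z.
Qed.

Hypotheses (d_gt0 : (0 < d)%N) (gammaP : admissible_choice d tau beta gamma).

(** The gradient has total degree d - 1 and no z; the square has degree two both in z and in total.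
    Recording the total degree d + 1 is what excludes z from the coefficients of top degree in Y. *)
Lemma bidegree_Q0 : bidegree d.+1 2 d Q0.
Proof.
have := bidegreeZ (weight_const (- 2^-1)) (bidegreeM (w := d) (N := d.-1) (e := 0)
  (p := \sum_i (tau 0 i)%:MP *: fY^`M(i)) _
  (@bidegreeX 1 1 (\sum_i (beta 0 i)%:MP *: Yz i) 2 _)).
rewrite !addn0 !add0n !muln1 addn2 prednK //; apply; apply: bidegree_sum => i _.
  by apply: (bidegreeZ (weight_const _)); apply: bidegree_deriv; apply: bidegree_fY.
by apply: (bidegreeZ (weight_const _)); apply: bidegree_Yz.
Qed.

Lemma bidegree_correction m : m \in msupp Q0 -> mdeg m = d.+1 -> bidegree d.+1 3 d
  (Q0@_m *: ((\prod_(i < 2) Yz i ^+ (gamma m i)) * 'X_[(m - gamma m)%MM])).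
Proof.
move=> mQ md; have [le gammaE] := gammaP mQ md.
have gamma3 : mdeg (gamma m) = 3%N := gammaE.
(* Here min(2, (d + 1) - (d + 1)) = 0, so h_m is free of z. *)
have w : weight 0 d (Q0@_m)%:F by have := bidegree_Q0.2 m; rewrite md subnn minn0.
have b3 : bidegree 3 3 0 (\prod_(i < 2) Yz i ^+ (gamma m i)).
  rewrite -gamma3 mdegE.
  elim/big_ind2: _ => [|p k q l kp lq|i _]; first exact: bidegree1.
    exact: (@bidegreeM _ _ 0 _ _ 0).
  by have := bidegreeX (gamma m i) (bidegree_Yz i); rewrite !muln1.
have := bidegreeZ w (bidegreeM b3 (bidegreeXm (m - gamma m)%MM)).
rewrite !addn0 !add0n; congr (bidegree _ _ _ _).
by have := congr1 mdeg (submK le); rewrite mdegD gamma3 md addnC.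
Qed.

Lemma bidegree_Qlog : bidegree d.+1 3 d Qlog.
Proof.
apply: bidegreeD; first by apply: bidegree_le bidegree_Q0.
apply: bidegreeN; rewrite big_seq_cond; apply: bidegree_sum => m /andP[mQ /eqP md].
exact: bidegree_correction.
Qed.

Lemma weight_qlog (m : 'X_{1..2 < d.+1}) : weight 3 d (qlog tau beta gamma m).
Proof. by apply: weight_le (bidegree_Qlog.2 m); apply: geq_minl. Qed.

Lemma msize_Qlog : (msize Qlog <= d.+1)%N.
Proof.
apply: deg_lt_msize; apply: deg_lt_sub_leading => [|m mQ md].
  exact: bidegree_Q0.1.
have [le _] := gammaP mQ md.
(* Splitting m as gamma m + (m - gamma m) matches the two factors of the correction, whose leading
   monomials multiply. *)
rewrite -[X in leading X](submK le) addmC.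
by apply: leadingM; [apply: leading_prodXB|apply: leadingX].
Qed.

End ParameterPolynomial.

(** Used with y = X_0 / X_i, a = tau_j and b = beta . xi, where y^2 b is regular: the square costs
    y^-4 and the division by X_i gives one power back. *)
Lemma pole_order (K : fieldType) (y a b : K) :
  y ^+ 3 * (a * b ^+ 2 * y) = a * (y ^+ 2 * b) ^+ 2.
Proof. ring. Qed.

(** * Prolonged gauge fields *)

Section Commuting.
Variables (K : fieldType) (D dl : K -> K) (DP : derivation D) (dlP : derivation dl).

Definition commuting x := dl (D x) = D (dl x).
(** [Dfield] is set to 0 on the coordinates of order two, where commutation with a prolonged field
    need not hold; hence no third derivative. *)
Definition commuting2 x := commuting x /\ commuting (D x).

Lemma commutingD x y : commuting x -> commuting y -> commuting (x + y).
Proof. by rewrite /commuting !(derD DP, derD dlP) => -> ->. Qed.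

Lemma commutingM x y : commuting x -> commuting y -> commuting (x * y).
Proof.
rewrite /commuting !(derM DP, derM dlP) !(derD DP, derD dlP) !(derM DP, derM dlP).
by move=> -> ->; ring.
Qed.

Lemma commuting2D x y : commuting2 x -> commuting2 y -> commuting2 (x + y).
Proof.
by move=> [x0 x1] [y0 y1]; rewrite /commuting2 (derD DP); split; apply: commutingD.
Qed.

Lemma commuting2M x y : commuting2 x -> commuting2 y -> commuting2 (x * y).
Proof.
move=> [x0 x1] [y0 y1]; rewrite /commuting2 (derM DP); split.
  exact: commutingM.
by apply: commutingD; apply: commutingM.
Qed.

Lemma commuting2_0 : commuting2 0.
Proof. by rewrite /commuting2 /commuting !(der0 DP) !(der0 dlP) !(der0 DP). Qed.

Lemma commuting2_1 : commuting2 1.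
Proof. by rewrite /commuting2 /commuting (der1 DP) (der1 dlP) !(der0 DP) (der0 dlP) (der0 DP). Qed.

Lemma commuting2_sum_prod (I J : finType) (r : K) n (a : I -> K) (z : J -> K)
    (m : I -> J -> nat) :
    commuting2 r -> (forall i, commuting2 (a i)) -> (forall j, commuting2 (z j)) ->
  commuting2 (r ^+ n + \sum_i a i * \prod_j z j ^+ m i j).
Proof.
move=> cr ca cz.
have cX x k : commuting2 x -> commuting2 (x ^+ k).
  move=> cx; elim: k => [|k IH]; first by rewrite expr0; apply: commuting2_1.
  by rewrite exprS; apply: commuting2M.
apply: commuting2D; first exact: cX.
elim/big_ind: _ => [||i _]; [exact: commuting2_0|exact: commuting2D|].
apply: commuting2M => //.
by elim/big_ind: _ => [||j _]; [exact: commuting2_1|exact: commuting2M|exact: cX].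
Qed.

(** Euler's relation: with weight 1 for each a_i and 1/n for r, every term has weight one. *)
Lemma euler_equation (I J : finType) (c r : K) n (a : I -> K) (z : J -> K)
    (m : I -> J -> nat) : (0 < n)%N -> n%:R != 0 :> K ->
    dl r = c * (r / n%:R) -> (forall i, dl (a i) = c * a i) -> (forall j, dl (z j) = 0) ->
  dl (r ^+ n + \sum_i a i * \prod_j z j ^+ m i j)
  = c * (r ^+ n + \sum_i a i * \prod_j z j ^+ m i j).
Proof.
move=> n_gt0 n0 dr da dz.
rewrite (derD dlP) (derX dlP) dr mulrDr; congr (_ + _).
  case: n n_gt0 n0 {dr} => // k _; rewrite /= exprS; move: (k.+1%:R) => N N0.
  by field.
rewrite (der_sum dlP) mulr_sumr; apply: eq_bigr => i _.
rewrite (derM dlP) da; have -> : dl (\prod_j z j ^+ m i j) = 0.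
  elim/big_ind: _ => [|x y x0 y0|j _]; first exact: (der1 dlP).
    by rewrite (derM dlP) x0 y0 mul0r mulr0 addr0.
  by rewrite (derX dlP) dz mulr0.
by rewrite mulr0 addr0 mulrA.
Qed.

Definition still x := dl x = 0 /\ dl (D x) = 0.

(** Second derivatives occur linearly in D (D (x / y)), and [dl] kills all else. What survives is
    the differential of x / y evaluated on the variations of the second derivatives. *)
Lemma der_accel_div x y : y != 0 -> still x -> still y ->
  dl (D (D (x / y))) = dl (D (D x)) / y - x / y * (dl (D (D y)) / y).
Proof.
move=> y0 [x1 x2] [y1 y2].
rewrite (der_div DP) // (der_div DP) ?expf_neq0 // expr2 (derB DP) !(derM DP).
rewrite (der_div dlP) ?mulf_neq0 ?expf_neq0 //.
rewrite !(derB dlP, derN dlP, derD dlP, derM dlP) x1 x2 y1 y2.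
by field.
Qed.

Lemma still_div x y : y != 0 -> still x -> still y -> still (x / y).
Proof.
move=> y0 [x1 x2] [y1 y2]; split; first by rewrite (der_div dlP) // x1 y1; field.
rewrite (der_div DP) // (der_div dlP) ?expf_neq0 // !expr2.
by rewrite (derB dlP) !(derM dlP) x1 x2 y1 y2; field.
Qed.

Lemma stillX x n : still x -> still (x ^+ n) /\
  dl (D (D (x ^+ n))) = n%:R * x ^+ n.-1 * dl (D (D x)).
Proof.
move=> [x1 x2]; elim: n => [|n [[IH1 IH2] IH3]].
  rewrite expr0 /still (der1 DP) (der1 dlP) !(der0 DP) (der0 dlP) !mul0r.
  by [].
rewrite exprS /still (DDM DP) (derM DP) !(derD dlP) !(derM dlP) x1 x2 IH1 IH2 IH3.
split; first by split; ring.
by case: n {IH1 IH2 IH3} => [|n] /=; rewrite ?expr0 ?exprS; ring.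
Qed.

(* g / x ^+ n is the equation in the chart where the homogeneous coordinate x is
   inverted; only its second derivative sees the acceleration of x. *)
Lemma der_chart_equation n c g x : x != 0 -> still x ->
  dl g = - (c * g) -> dl (D g) = - (c * D g) -> dl (D (D g)) = - (c * D (D g)) ->
  [/\ dl (g / x ^+ n) = - c * (g / x ^+ n),
      dl (D (g / x ^+ n)) = - c * D (g / x ^+ n) &
      dl (D (D (g / x ^+ n))) = - c * D (D (g / x ^+ n))
        - n%:R * (dl (D (D x)) / x) * (g / x ^+ n)].
Proof.
move=> x0 xs g0 g1 g2; have [[y1 y2] y3] := stillX n xs.
have yn0 : x ^+ n != 0 by rewrite expf_neq0.
have [|i1 i2] := still_div yn0 _ (conj y1 y2) (x := 1).
  by rewrite /still (der1 DP) (der1 dlP) (der0 dlP).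
have i3 : dl (D (D (x ^+ n)^-1)) = - (n%:R * (dl (D (D x)) / x) / x ^+ n).
  have := der_accel_div yn0 (x := 1) _ (conj y1 y2).
  rewrite !div1r /still (der1 DP) (der1 dlP) (der0 dlP) (der0 DP) (der0 dlP) y3 => /(_ _)->//.
  case: (n) => [|k] /=; first by rewrite !mul0r mulr0 subr0 oppr0.
  by rewrite exprS; field; rewrite x0 expf_neq0.
move: i1 i2 i3; rewrite div1r; set y := (x ^+ n)^-1 => i1 i2 i3.
split.
- by rewrite (derM dlP) g0 i1; ring.
- by rewrite (derM DP) (derD dlP) !(derM dlP) g0 g1 i1 i2; ring.
- by rewrite (DDM DP) !(derD dlP) !(derM dlP) g0 g1 g2 i1 i2 i3; ring.
Qed.

Lemma log_der_div r x l : r != 0 -> x != 0 -> D r = r * l ->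
  D (r / x) / (r / x) = l - D x / x.
Proof. by move=> r0 x0 rl; rewrite (der_div DP) // rl; field; rewrite r0 x0. Qed.

(** With x the logarithmic derivative of z_3 and y = X_i, x - y' / y is that of the chart root z_3 /
    X_i, which feels the acceleration of X_i alone. *)
Lemma der_log_correction x y : y != 0 -> dl x = 0 -> dl (D x) = 0 -> still y ->
  dl (x - D y / y) = 0 /\ dl (D (x - D y / y)) = - (dl (D (D y)) / y).
Proof.
move=> y0 x1 x2 [y1 y2]; split.
  by rewrite (derB dlP) x1 (der_div dlP) // y1 y2; field.
rewrite (derB DP) (derB dlP) x2 (der_div DP) // (der_div dlP) ?expf_neq0 //.
by rewrite (derB dlP) expr2 !(derM dlP) y1 y2; field.
Qed.

Lemma der_cleared z v y : y != 0 -> z = v / y -> y ^+ 2 * D z = D v * y - v * D y.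
Proof. by move=> y0 ->; rewrite (der_div DP) //; field. Qed.

End Commuting.

Section Gauge.
Variables (R : realType) (d : nat).
Local Notation C := (complex R).
Local Notation P := (jetpoly R d).
Local Notation F := (jetfun R d).
Local Notation "p %:F" := (@FracField.tofrac P p).
Local Notation cX := (@cX R d).
Local Notation cst := (@cst R d).
Local Notation D := (@D R d).
Local Notation coord := (Defs.coord d).
Local Notation gauge := (@gauge R d).
Local Notation acoef := (@acoef R d).
Local Notation Elog := (@Elog R d).
Local Notation G := (@Defs.G R d).
Implicit Types (phi : coord -> F) (x : coord) (g h c : F).

Lemma in_ideal_term phi s (I : finType) (e : I -> F) i h :
  regular phi s h -> in_ideal phi s e (h * e i).
Proof.
move=> rh; exists (fun j => if j == i then h else 0).
  by move=> j; case: ifP => _ //; apply: regular0.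
rewrite (bigD1 i) //= eqxx big1 ?addr0 // => j /negPf ->; exact: mul0r.
Qed.

Lemma in_idealD phi t s (I : finType) (e : I -> F) g h : s = msubst phi t ->
  in_ideal phi s e g -> in_ideal phi s e h -> in_ideal phi s e (g + h).
Proof.
move=> sE [u ru ->] [v rv ->]; exists (fun i => u i + v i).
  by move=> i; apply: (regularD sE).
by rewrite -big_split; apply: eq_bigr => i _; rewrite mulrDl.
Qed.

Lemma natF_neq0 n : (0 < n)%N -> n%:R != 0 :> F.
Proof.
move=> n_gt0; rewrite -(rmorph_nat cst); apply: cst_neq0.
by rewrite Num.Theory.pnatr_eq0 -lt0n.
Qed.

Lemma GE : G%:F = cX (rc k0) ^+ d +
  \sum_(m : 'X_{1..2 < d.+1}) cX (ac k0 m) * \prod_(i < 2) cX (zc k0 i) ^+ (m i).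
Proof.
rewrite rmorphD rmorphXn rmorph_sum; congr (_ + _); apply: eq_bigr => m _.
rewrite rmorphM rmorph_prod; congr (_ * _); apply: eq_bigr => i _.
by rewrite rmorphXn.
Qed.

Lemma gauge_z c (k : 'I_3) i : gauge c (zc k i) = 0.
Proof.
rewrite /Defs.gauge /prolong /= mulr0.
by elim: (k : nat) => //= n ->; apply: (der0 (D_derivation R d)).
Qed.

Lemma gauge_a c (k : 'I_3) m : gauge c (ac k m) = iter k D (c * acoef m).
Proof. by []. Qed.

Lemma gauge_root c : gauge c (rc k0) = c * (cX (rc k0) / d%:R).
Proof. by []. Qed.

(** The prolongation differentiates X(z_3) / z_3, and the factor z_3 of the Euler component
    cancels. *)
Lemma gauge_log c (k : 'I_3) : (0 < k)%N -> gauge c (rc k) = iter k D (c / d%:R).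
Proof.
move=> k_gt0; rewrite /Defs.gauge /prolong /= -[_ == _]negbK -lt0n k_gt0 /=.
by rewrite mulrCA mulrAC divff ?cX_neq0 ?mul1r.
Qed.

Lemma gaugeB c c' x : gauge (c - c') x = gauge c x - gauge c' x.
Proof.
have iterB k g h : iter k D (g - h) = iter k D g - iter k D h.
  by elim: k => //= k ->; apply: (derB (D_derivation R d)).
by case: x => k [i|[[]|m]]; rewrite /Defs.gauge /prolong /=; try case: ifP => _;
  rewrite ?mulrBl ?iterB // mulrBl.
Qed.

Lemma gauge_commuting2 c : commuting2 D (lie (gauge c)) G%:F.
Proof.
have DP := D_derivation R d; have gP := lie_derivation (gauge c).
rewrite GE; apply: commuting2_sum_prod => // [|m|i].
- rewrite /commuting2 D_r.
  (* For z and a, commutation is built into the prolongation; for z_3 it is recovered from the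
     logarithmic jets by Leibniz' rule. *)
  have c0 : commuting D (lie (gauge c)) (cX (rc k0)).
    rewrite /commuting D_r (derM gP) !lie_cX gauge_root (gauge_log c (k := k1)) //=.
    have -> : c * (cX (rc k0) / d%:R) = c / d%:R * cX (rc k0) by rewrite mulrCA mulrC.
    by rewrite [RHS](derM DP) D_r addrC mulrA [D _ * _]mulrC.
  split=> //; apply: (commutingM DP gP) => //.
  by rewrite /commuting D_r !lie_cX !gauge_log.
- by rewrite /commuting2 /commuting !D_a !lie_cX !gauge_a.
- by rewrite /commuting2 /commuting !D_z !lie_cX !gauge_z !(der0 DP).
Qed.

Lemma gauge_G c : (0 < d)%N -> lie (gauge c) G%:F = c * G%:F.
Proof.
move=> d_gt0; rewrite GE; apply: (euler_equation (lie_derivation _)) => //.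
- exact: natF_neq0.
- exact: lie_cX.
- by move=> m; rewrite lie_cX.
- by move=> j; rewrite lie_cX gauge_z.
Qed.

Lemma gauge_Elog c j : (0 < d)%N -> lie (gauge c) (Elog j) = iter j D (c * G%:F).
Proof.
move=> d_gt0; have [c0 c1] := gauge_commuting2 c.
elim/ord3P: j; rewrite /Defs.Elog /=; first exact: gauge_G.
  by rewrite c0 gauge_G.
by rewrite c1 c0 gauge_G.
Qed.

End Gauge.

(** * The corrected field *)

Section AccelerationField.
Variables (R : realType) (d : nat).
Local Notation C := (complex R).
Local Notation P := (jetpoly R d).
Local Notation F := (jetfun R d).
Local Notation "p %:F" := (@FracField.tofrac P p).
Local Notation cX := (@cX R d).
Local Notation cst := (@cst R d).
Local Notation D := (@D R d).
Local Notation coord := (Defs.coord d).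
Local Notation gauge := (@gauge R d).
Local Notation acoef := (@acoef R d).
Local Notation Elog := (@Elog R d).
Local Notation G := (@Defs.G R d).
Implicit Types (phi : coord -> F) (x : coord) (g h c : F).

Variables (tau beta : 'rV[C]_2) (gamma : 'X_{1..2} -> 'X_{1..2}).
Hypotheses (d_gt0 : (0 < d)%N) (gammaP : admissible_choice d tau beta gamma).
Local Notation V := (accel (d := d) tau beta gamma).
Local Notation q := (qlog (d := d) tau beta gamma).
Local Notation corr := (@corrected R d tau beta gamma).

Definition speed : F := \sum_(j < 2) cst (beta 0 j) * cX (zc k1 j).
Definition gauge_factor rho : F := q rho / acoef rho.
(* Prolonging with the function c frozen keeps a^(1) = a^(2) = 0 invariant, unlike
   the full prolongation; the difference is a combination of gauge fields. *)
Definition vertical rho : vfield R d := fun x => V x - gauge_factor rho * gauge 1 x.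

Let DP := D_derivation R d.
Let VP := lie_derivation V.

Lemma accel_Elog j : lie V (Elog j) = 0.
Proof.
have two0 : 2%:R != 0 :> F by apply: natF_neq0.
suff [e0 e1 e2] : killed D (lie V) G%:F by elim/ord3P: j.
rewrite GE.
apply: (@accel_kills_equation _ _ (@FracField.tofrac P) D (lie V) DP VP
  (fun i => cX (zc k0 i)) (fun i => cX (zc k1 i)) (fun i => cX (zc k2 i))
  (fun i => cst (tau 0 i) * speed ^+ 2) _ _ _ _ _ two0
  (fun i => pX R (zc k0 i)) _ d (fun m => pX R (ac k0 m)) (cX (rc k0) ^+ d)
  (fun i => (tau 0 i)%:MP) (fun i => (beta 0 i)%:MP) (- (2%:R^-1))%:MP
  (Qlog d tau beta gamma)
  (\sum_(m <- msupp (Q0 d tau beta) | mdeg m == d.+1)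
     (Q0 d tau beta)@_m *: ((\prod_(i < 2) (Yz R d i) ^+ (gamma m i)) * 'X_[(m - gamma m)%MM]))).
- by move=> i; rewrite D_z.
- by move=> i; rewrite D_z.
- by move=> i; rewrite lie_cX.
- by move=> i; rewrite lie_cX.
- by move=> i; rewrite lie_cX.
- by [].
- by [].
- rewrite -[LHS]/(cst (- 2^-1)) rmorphN fmorphV; congr (- _^-1).
  exact: rmorph_nat.
- by [].
- apply: Taylor_sum_multiple => m mQ /eqP md; have [_ gamma3] := gammaP mQ md.
  exact: Taylor_prodXB.
- exact: msize_Qlog.
(* V fixes z_3 and its logarithmic jets, so z_3^d drops out. *)
- apply: killedX => //; split.
  + by rewrite lie_cX.
  + by rewrite D_r (derM VP) !lie_cX /= mul0r mulr0 addr0.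
  + rewrite D_r (derM DP) !D_r (derD VP) !(derM VP) !lie_cX /=.
    by rewrite !(mul0r, mulr0, addr0).
- by move=> m; rewrite lie_cX.
- by move=> m; rewrite D_a lie_cX.
- by move=> m; rewrite !D_a lie_cX.
Qed.

Lemma weight_q m : weight 3 d (q m).
Proof. exact: weight_qlog. Qed.

Lemma order0_factor rho : order0 (gauge_factor rho).
Proof.
apply: order0M; first by case: (weight_q rho).
by apply: order0V; apply: order0_cX.
Qed.

Lemma acoef_msubst phi m : phi (ac k0 m) = acoef m ->
  acoef m = msubst phi (pX R (ac k0 m)).
Proof. by rewrite msubst_pX. Qed.

Lemma regular_factor rho sigma :
  regular cX (acoef rho * acoef sigma) (gauge_factor rho).
Proof.
apply: (@regular_div R d cX _ _ (q rho * acoef sigma)).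
  by rewrite /gauge_factor mulrA divfK // acoef_neq0.
by apply: regularM; apply: regular_poly.
Qed.

Lemma regular_factor1 rho : regular cX (acoef rho) (gauge_factor rho).
Proof.
apply: (@regular_div R d cX _ _ (q rho)); first by rewrite /gauge_factor divfK // acoef_neq0.
exact: regular_poly.
Qed.

Lemma corrected_lie rho g : lie (corr rho) g = lie V g - lie (gauge (gauge_factor rho)) g.
Proof. exact: lieBl. Qed.

Lemma vertical_lie rho g :
  lie (vertical rho) g = lie V g - gauge_factor rho * lie (gauge 1) g.
Proof. by rewrite -lieZl -lieBl. Qed.

Lemma regular_accel rho x : regular cX (acoef rho) (V x).
Proof.
case: x => k [i|[[]|m]]; rewrite /= -?/speed.
- case: ifP => _; last exact: regular0.
  apply: regularM; first exact: regular_cst.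
  apply: regularX; apply: (regular_sum (acoef_msubst (phi := cX) erefl)) => j _.
  by apply: regularM; [apply: regular_cst|apply: regular_coord].
- exact: regular0.
- by case: ifP => _; [apply: regular_poly|apply: regular0].
Qed.

Lemma regular_iter_D rho g k : regular cX (acoef rho) g -> regular cX (acoef rho) (iter k D g).
Proof.
move=> rg; elim: k => //= k IH.
exact: (regular_D (acoef_msubst (phi := cX) erefl) (acoef_neq0 _ _)).
Qed.

Lemma regular_divd phi s g : regular phi s g -> regular phi s (g / d%:R).
Proof.
move=> rg; apply: regularM => //; rewrite -(rmorph_nat cst) -fmorphV.
exact: regular_cst.
Qed.

Lemma regular_gauge rho c x : regular cX (acoef rho) c -> regular cX (acoef rho) (gauge c x).
Proof.
move=> rc; case: x => k [i|[[]|m]].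
- by rewrite gauge_z; apply: regular0.
- elim/ord3P: k.
  + rewrite gauge_root; apply: regularM => //; apply: regular_divd; exact: regular_coord.
  + by rewrite gauge_log //; apply: regular_iter_D; apply: regular_divd.
  + by rewrite gauge_log //; apply: regular_iter_D; apply: regular_divd.
- rewrite gauge_a; apply: regular_iter_D; apply: regularM => //; exact: regular_coord.
Qed.

Lemma corrected_is_regular rho x : regular cX (acoef rho) (corr rho x).
Proof.
apply: (regularB (acoef_msubst (phi := cX) erefl)); first exact: regular_accel.
by apply: regular_gauge; apply: regular_factor1.
Qed.

Lemma corrected_is_tangent rho : preserves cX (acoef rho) 1 (corr rho) Elog.
Proof.
have aE := acoef_msubst (phi := cX) (m := rho) erefl.
move=> j; rewrite mul1r corrected_lie accel_Elog sub0r gauge_Elog //.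
set c := gauge_factor rho; have rc k : regular cX (acoef rho) (iter k D c).
  by apply: regular_iter_D; apply: regular_factor1.
have term k i : in_ideal cX (acoef rho) Elog (- iter k D c * Elog i).
  by apply: in_ideal_term; apply: regularN.
elim/ord3P: j => /=.
- by rewrite -mulNr; apply: (term 0%N k0).
- rewrite (derM DP) opprD.
  by apply: (in_idealD aE); rewrite -mulNr; [apply: (term 1%N k0)|apply: (term 0%N k1)].
- rewrite (DDM DP) mulr2n !opprD.
  apply: (in_idealD aE); last by rewrite -mulNr; apply: (term 0%N k2).
  apply: (in_idealD aE); first by rewrite -mulNr; apply: (term 2%N k0).
  by apply: (in_idealD aE); rewrite -mulNr; apply: (term 1%N k1).
Qed.

Lemma corrected_is_normalized rho : corr rho (ac k0 rho) = 0.
Proof. by rewrite /corrected gauge_a /= divfK ?subrr // acoef_neq0. Qed.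

Lemma corrected_boundary rho : preserves_boundary rho (corr rho).
Proof.
move=> []; rewrite mul1r corrected_lie !lie_cX gauge_root sub0r.
have -> : - (gauge_factor rho * (cX (rc k0) / d%:R))
    = - (gauge_factor rho / d%:R) * cX (rc k0) by rewrite mulNr mulrA mulrAC.
apply: (@in_ideal_term _ _ _ _ _ (@root3 R d) tt).
by apply: regularN; apply: regular_divd; apply: regular_factor1.
Qed.

(** As [D] kills 1 / d, [gauge 1] scales z_3 and all jets of the coefficients and fixes the
    logarithmic derivatives. The components along a^(1), a^(2) are thus multiples of those
    coordinates. *)
Lemma verticalE rho x : vertical rho x = match x with
  | (k, inl i) => if k == 2%N :> nat then cst (tau 0 i) * speed ^+ 2 else 0
  | (k, inr (inl _)) =>
      if k == 0%N :> nat then - (gauge_factor rho / d%:R * cX (rc k0)) else 0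
  | (k, inr (inr m)) =>
      (if k == 0%N :> nat then q m else 0) - gauge_factor rho * cX (ac k m)
  end.
Proof.
have Dd : D (1 / d%:R) = 0 by rewrite div1r -(rmorph_nat cst) -fmorphV; apply: lie_cst.
rewrite /vertical; case: x => k [i|[[]|m]].
- by rewrite gauge_z mulr0 subr0.
- elim/ord3P: k.
  + by rewrite [V _]/= gauge_root mul1r sub0r mulrA mulrAC.
  + by rewrite [V _]/= gauge_log // [iter _ _ _]/= Dd mulr0 subr0.
  + by rewrite [V _]/= gauge_log // [iter _ _ _]/= Dd (der0 DP) mulr0 subr0.
- rewrite gauge_a mul1r; congr (_ - _ * _).
  by elim/ord3P: k; rewrite //= !D_a.
Qed.

Lemma vertical_boundary rho : preserves_boundary rho (vertical rho).
Proof.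
move=> []; rewrite mul1r lie_cX verticalE /= -mulNr.
apply: (@in_ideal_term _ _ _ _ _ (@root3 R d) tt).
by apply: regularN; apply: regular_divd; apply: regular_factor1.
Qed.

(** * Equivariance under substitutions *)

Section Substitution.
Variables (phi0 : coord -> P) (s : {rmorphism F -> F}).
Hypotheses (inj : injective (@msubst R d (fun y => (phi0 y)%:F)))
  (sE : fsubst (fun y => (phi0 y)%:F) =1 s).

Lemma subst_cX x : s (cX x) = (phi0 x)%:F.
Proof. by rewrite -sE fsubst_poly // msubst_pX. Qed.

Lemma subst_cst a : s (cst a) = cst a.
Proof. by rewrite -sE fsubst_poly // msubstC. Qed.

Lemma equivariantB (U U' : vfield R d) : equivariant phi0 U -> equivariant phi0 U' ->
  equivariant phi0 (fun x => U x - U' x).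
Proof. by move=> eU eU' x; rewrite lieBl eU eU' !sE rmorphB. Qed.

Lemma equivariantZ c (U : vfield R d) : s c = c -> equivariant phi0 U ->
  equivariant phi0 (fun x => c * U x).
Proof. by move=> sc eU x; rewrite lieZl eU !sE rmorphM /= sc. Qed.
End Substitution.

Lemma lie_tofracZ (U : vfield R d) a p : lie U (a *: p)%:F = cst a * lie U p%:F.
Proof. by rewrite tofracZ; apply: derZ (lie_derivation U) _ _ _; apply: lie_cst. Qed.

Section Reparametrization.
Variables (b1 b2 : C) (s : {rmorphism F -> F}).
Hypotheses (b1_neq0 : b1 != 0) (sE : fsubst (fun y => (reparam b1 b2 y)%:F) =1 s).
Let inj := @reparam_inj R d b1 b2 b1_neq0.

Lemma reparam_equivariantP (U : vfield R d) :
    (forall b, [/\ s (U (k0, b)) = U (k0, b), s (U (k1, b)) = cst b1 * U (k1, b) &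
       s (U (k2, b)) = cst b1 ^+ 2 * U (k2, b) + cst b2 * U (k1, b)]) ->
  equivariant (reparam b1 b2) U.
Proof.
move=> sU [k b]; have [s0 s1 s2] := sU b; rewrite sE.
elim/ord3P: k; rewrite /reparam [fst _]/= [snd _]/= [(_ == _)]/= ?[(_ == _ :> nat)]/=.
- by rewrite s0; apply: lie_cX.
- by rewrite s1 lie_tofracZ; congr (_ * _); apply: lie_cX.
- rewrite s2 rmorphD (derD (lie_derivation U)) !lie_tofracZ rmorphXn.
  by congr (_ * _ + _ * _); apply: lie_cX.
Qed.

Lemma covariant_factor rho : covariant D s (cst b1) (cst b2) (gauge_factor rho).
Proof.
apply: (covariantM DP); first exact: (weight_covariant (weight_q rho)).
by apply: (covariantV DP); apply: covariant_base.
Qed.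

Lemma covariant_const a : covariant D s (cst b1) (cst b2) (cst a).
Proof. exact: (weight_covariant (weight_cst _ a)). Qed.

Lemma subst_speed : s speed = cst b1 * speed.
Proof.
rewrite /speed rmorph_sum mulr_sumr; apply: eq_bigr => j _.
rewrite rmorphM /= (subst_cst inj sE) (subst_cX inj sE) mulrCA; congr (_ * _).
by rewrite /reparam /= tofracZ.
Qed.

Lemma reparam_accel : equivariant (reparam b1 b2) V.
Proof.
apply: reparam_equivariantP => -[i|[[]|m]]; rewrite /= -?/speed ?rmorph0 ?mulr0 ?addr0.
- split=> //; rewrite rmorphM rmorphXn /= subst_speed (subst_cst inj sE).
  by rewrite exprMn mulrCA.
- by [].
- by split=> //; have [] := weight_covariant (weight_q m) b1_neq0 sE.
Qed.

Lemma reparam_gauge c : covariant D s (cst b1) (cst b2) c ->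
  equivariant (reparam b1 b2) (gauge c).
Proof.
move=> cc.
have cd : covariant D s (cst b1) (cst b2) (c / d%:R).
  apply: (covariantM DP) => //; rewrite -(rmorph_nat cst) -fmorphV.
  exact: covariant_const.
apply: reparam_equivariantP => -[i|[[]|m]].
- by rewrite !gauge_z rmorph0 !mulr0 addr0.
- rewrite gauge_root !gauge_log //; have [_ d1 d2] := cd; split=> //.
  have -> : c * (cX (rc k0) / d%:R) = c / d%:R * cX (rc k0) by rewrite mulrA mulrAC.
  have [d0 _ _] := cd; rewrite rmorphM /= d0 (subst_cX inj sE).
  by rewrite /reparam.
- by rewrite !gauge_a; apply: (covariantM DP) => //; apply: covariant_base.
Qed.
End Reparametrization.

Lemma corrected_reparam rho : reparam_equivariant (corr rho).
Proof.
move=> b1 b2 b1_neq0; have [s sE] := fsubst_rmorph (@reparam_inj R d b1 b2 b1_neq0).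
apply: (equivariantB sE); first exact: reparam_accel sE.
by apply: (reparam_gauge b1_neq0 sE); apply: covariant_factor.
Qed.

Lemma vertical_reparam rho : reparam_equivariant (vertical rho).
Proof.
move=> b1 b2 b1_neq0; have [s sE] := fsubst_rmorph (@reparam_inj R d b1 b2 b1_neq0).
apply: (equivariantB sE); first exact: reparam_accel sE.
apply: (equivariantZ sE); first by have [] := covariant_factor b1_neq0 sE rho.
apply: (reparam_gauge b1_neq0 sE); rewrite -(rmorph1 cst); exact: covariant_const.
Qed.

Lemma vertical_rescale rho (mu : C) : mu != 0 -> equivariant (rescale mu) (vertical rho).
Proof.
move=> mu0; have inj := @rescale_inj R d mu mu0; have [s sE] := fsubst_rmorph inj.
have sq m : s (q m) = cst mu ^+ d * q m by rewrite -sE (weight_rescale (weight_q m)).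
have sa (k : 'I_3) m : s (cX (ac k m)) = cst mu ^+ d * cX (ac k m).
  by rewrite (subst_cX inj sE) /= tofracZ rmorphXn.
(* Both q_rho and a_rho scale by mu^d. *)
have sc : s (gauge_factor rho) = gauge_factor rho.
  rewrite /gauge_factor fmorph_div sq sa -mulf_div divff ?mul1r //.
  by rewrite expf_neq0 // cst_neq0.
move=> x; rewrite sE verticalE; case: x => k [i|[[]|m]].
- rewrite lie_cX verticalE; case: ifP => _; last by rewrite rmorph0.
  rewrite rmorphM rmorphXn /= (subst_cst inj sE) rmorph_sum; congr (_ * _ ^+ _).
  apply: eq_bigr => j _.
  by rewrite rmorphM /= (subst_cst inj sE) (subst_cX inj sE).
- rewrite /rescale; case: ifP => k_0.
    rewrite lie_tofracZ [lie _ _]lie_cX verticalE k_0 rmorphN rmorphM fmorph_div /= sc.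
    rewrite rmorph_nat (subst_cX inj sE) /= tofracZ mulrN.
    by rewrite mulrCA.
  by rewrite lie_cX verticalE k_0 rmorph0.
- rewrite lie_tofracZ [lie _ _]lie_cX verticalE rmorphB rmorphM /= sc sa rmorphXn /=.
  rewrite mulrBr [X in _ = _ - X]mulrCA; congr (_ - _).
  by case: ifP => _; rewrite ?sq // rmorph0 mulr0.
Qed.

Lemma vertical_preserves_ajets rho : preserves cX (acoef rho) 1 (vertical rho) (@ajets R d).
Proof.
move=> [k m]; rewrite mul1r lie_cX verticalE /= sub0r -mulNr.
apply: (@in_ideal_term _ _ _ _ _ (@ajets R d) (k, m)).
by apply: regularN; apply: regular_factor1.
Qed.

Lemma regular_overlap rho sigma :
  regular cX (acoef rho * acoef sigma) (gauge_factor sigma - gauge_factor rho).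
Proof.
apply: (@regularB R d cX (pX R (ac k0 rho) * pX R (ac k0 sigma))).
- by rewrite rmorphM /= !msubst_pX.
- by rewrite mulrC; apply: regular_factor.
- exact: regular_factor.
Qed.

Lemma vertical_descends : descends tau beta gamma vertical.
Proof.
split.
- exact: corrected_is_regular.
- exact: corrected_is_tangent.
- exact: corrected_is_normalized.
(* V is the same in all coefficient charts and cancels; the gauge field is additive in its
   function. *)
- move=> rho sigma; exists (gauge_factor sigma - gauge_factor rho); split.
  + by apply: order0D; [|apply: order0N]; apply: order0_factor.
  + exact: regular_overlap.
  + move=> x; by rewrite gaugeB /corrected opprB addrC subrKA.
(* The difference is [gauge] of c_rho minus c_rho times [gauge 1], a combination of the gauge fields
   of c_rho and of 1. *)
- move=> rho; exists [:: (1, gauge_factor rho); (- gauge_factor rho, 1)]; split.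
  + have o1 : @order0 R d 1 by rewrite -(rmorph1 cst); apply: order0_cst.
    move=> p; rewrite !inE => /orP[] /eqP-> /=; split=> //.
    * exact: regular1.
    * exact: regular_factor1.
    * exact: order0_factor.
    * by apply: regularN; apply: regular_factor1.
    * exact: regular1.
  + move=> x; rewrite !big_cons big_nil addr0 /= mul1r mulNr /vertical /corrected.
    by rewrite opprB addrC subrKA.
- exact: vertical_preserves_ajets.
- by move=> rho; rewrite verticalE /= divfK ?subrr // acoef_neq0.
- exact: vertical_rescale.
- move=> rho sigma; exists (gauge_factor sigma - gauge_factor rho).
    exact: regular_overlap.
  by move=> x; rewrite /vertical opprB addrC subrKA mulrBl.
Qed.

(** * Poles in the charts of the projective plane *)

Local Notation hom := (@Defs.hom R d).
Local Notation chart := (@Defs.chart R d).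

Definition slope (j : 'I_3) : C := if unlift ord0 j is Some l then tau 0 l else 0.

Section Chart.
Variables (rho : 'X_{1..2 < d.+1}) (i : 'I_3).
Local Notation W := (vertical rho).
Local Notation u := (hom ord0 / hom i).
Local Notation s := (acoef rho).
Local Notation c := (gauge_factor rho).

Let WP := lie_derivation W.
Let sE : s = msubst (chart i) (pX R (ac k0 rho)) := acoef_msubst (phi := chart i) erefl.

Lemma hom_still j : still D (lie W) (hom j).
Proof.
rewrite /still; case: (unliftP ord0 j) => [l|] ->.
  by rewrite hom_lift D_z !lie_cX !verticalE.
by rewrite hom0 (der1 DP) (der1 WP) (der0 WP).
Qed.

Lemma lie_DD_hom j : lie W (D (D (hom j))) = cst (slope j) * speed ^+ 2.
Proof.
rewrite /slope; case: (unliftP ord0 j) => [l|] ->.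
  by rewrite hom_lift !D_z lie_cX verticalE.
by rewrite hom0 (der1 DP) (der0 DP) (der0 WP) rmorph0 mul0r.
Qed.

Lemma hom0_ratio : u = (hom i)^-1. Proof. by rewrite hom0 div1r. Qed.

(** From z_l = v_l / u one gets z_l' = (v_l' u - v_l u') / u^2, a pole of order two at u = 0. *)
Lemma regular_speed : regular (chart i) s (u ^+ 2 * speed).
Proof.
have DE (l : 'I_2) : u ^+ 2 * cX (zc k1 l) = D (hom (lift ord0 l) / hom i) * u
    - hom (lift ord0 l) / hom i * D u.
  have u0 : u != 0 by rewrite hom0_ratio invr_neq0 // hom_neq0.
  rewrite -D_z; apply: (der_cleared DP) => //.
  by rewrite hom0_ratio invrK divfK ?hom_neq0 // hom_lift.
rewrite /speed mulr_sumr; apply: (regular_sum sE) => l _; rewrite mulrCA.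
apply: regularM; first exact: regular_cst.
rewrite DE; apply: (regularB sE); apply: regularM.
- exact: (@regular_ratio R d i _ _ 1).
- exact: (@regular_ratio R d i _ _ 0).
- exact: (@regular_ratio R d i _ _ 0).
- exact: (@regular_ratio R d i _ _ 1).
Qed.

Lemma regular_acceleration j :
  regular (chart i) s (u ^+ 3 * (lie W (D (D (hom j))) / hom i)).
Proof.
rewrite lie_DD_hom hom0_ratio pole_order -hom0_ratio.
apply: regularM; first exact: regular_cst.
by apply: regularX; apply: regular_speed.
Qed.

Lemma regular_twisted_q m : regular (chart i) s (u ^+ 3 * q m).
Proof. exact: regular_loc (weight_pole (weight_q m) i). Qed.

Lemma regular_twisted_factor : regular (chart i) s (u ^+ 3 * c).
Proof.
apply: (regular_div (h := u ^+ 3 * q rho)); last exact: regular_twisted_q.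
by rewrite -mulrA /gauge_factor divfK ?acoef_neq0.
Qed.

Lemma lie_chart_root : lie W (cX (rc k0) / hom i) = - (c / d%:R) * (cX (rc k0) / hom i).
Proof.
have [h0 _] := hom_still i.
rewrite (derM WP) lie_cX verticalE [LHS]/= (derV WP) ?hom_neq0 // h0 oppr0 mul0r mulr0.
by rewrite addr0 -mulNr -mulrA.
Qed.

Lemma lie_chart_log : lie W (D (cX (rc k0) / hom i) / (cX (rc k0) / hom i)) = 0 /\
  lie W (D (D (cX (rc k0) / hom i) / (cX (rc k0) / hom i)))
    = - (lie W (D (D (hom i))) / hom i).
Proof.
have [h0 h1] := hom_still i; have hi := hom_neq0 R d i.
have -> := log_der_div DP (cX_neq0 R (rc k0)) hi (D_r R d).1.
apply: (der_log_correction DP WP) => //; first by rewrite lie_cX verticalE.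
by rewrite D_r lie_cX verticalE.
Qed.

Lemma vertical_chart x : regular (chart i) s (u ^+ 3 * lie W (chart i x)).
Proof.
have tc0 : regular (chart i) s (u ^+ 3 * 0) by rewrite mulr0; apply: regular0.
have [r1 r2] := lie_chart_log.
case: x => k [l|[[]|m]].
- have [v0 v1] := still_div DP WP (hom_neq0 R d i) (hom_still (lift i l)) (hom_still i).
  elim/ord3P: k => /=; rewrite ?v0 ?v1 //.
  (* X_l and X_i both accelerate; the term from X_i carries the regular factor X_l / X_i and adds no
     further pole. *)
  rewrite (der_accel_div DP WP (hom_neq0 R d i) (hom_still _) (hom_still _)) mulrBr.
  apply: (regularB sE); first exact: regular_acceleration.
  rewrite mulrCA; apply: regularM; last exact: regular_acceleration.
  exact: (@regular_ratio R d i _ _ 0).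
- elim/ord3P: k; rewrite [chart i _]/= /chart_root.
  + rewrite lie_chart_root mulNr mulrN; apply: regularN; rewrite mulrA.
    apply: regularM; last exact: (regular_coord (chart i) s (rc k0)).
    by rewrite mulrA; apply: regular_divd; apply: regular_twisted_factor.
  + by rewrite r1.
  + by rewrite r2 mulrN; apply: regularN; apply: regular_acceleration.
- rewrite [chart i _]/= lie_cX verticalE mulrBr; apply: (regularB sE).
    by case: ifP => _ //; apply: regular_twisted_q.
  rewrite mulrA; apply: regularM; first exact: regular_twisted_factor.
  exact: (regular_coord (chart i) s (ac k m)).
Qed.

Lemma vertical_chart_Elog : preserves (chart i) s (u ^+ 3) W (@chart_Elog R d i).
Proof.
have wE k : lie W (Elog k) = - (c * Elog k).
  by rewrite vertical_lie accel_Elog gauge_Elog // mul1r sub0r.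
have [e0 e1 e2] := der_chart_equation DP WP d (hom_neq0 R d i) (hom_still i)
  (wE k0) (wE k1) (wE k2).
have term k : in_ideal (chart i) s (@chart_Elog R d i)
    (u ^+ 3 * (- c * @chart_Elog R d i k)).
  rewrite mulrA; apply: in_ideal_term; rewrite mulrN; apply: regularN.
  exact: regular_twisted_factor.
elim/ord3P.
- by rewrite [lie _ _]e0; apply: (term k0).
- by rewrite [lie _ _]e1; apply: (term k1).
(* Dividing G by X_i^d brings in the acceleration of X_i, but only as a multiple of the equation of
   order zero; the twist clears its pole. *)
- rewrite [lie _ _]e2 mulrBr; apply: (in_idealD sE); first exact: (term k2).
  rewrite [u ^+ 3 * _]mulrA -mulNr.
  apply: (@in_ideal_term _ _ _ _ _ (@chart_Elog R d i) k0).
  apply: regularN; rewrite mulrCA; apply: regularM; first exact: regular_nat.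
  exact: regular_acceleration.
Qed.

Lemma vertical_chart_ajets : preserves (chart i) s (u ^+ 3) W (@ajets R d).
Proof.
move=> [k m]; rewrite lie_cX verticalE /= sub0r mulrN mulrA -mulNr.
apply: (@in_ideal_term _ _ _ _ _ (@ajets R d) (k, m)).
by apply: regularN; apply: regular_twisted_factor.
Qed.

Lemma vertical_chart_boundary : preserves (chart i) s (u ^+ 3) W (@chart_root R d i).
Proof.
move=> []; rewrite [lie _ _]lie_chart_root mulrA.
apply: (@in_ideal_term _ _ _ _ _ (@chart_root R d i) tt).
rewrite mulrN; apply: regularN; rewrite mulrA; apply: regular_divd.
exact: regular_twisted_factor.
Qed.
End Chart.

Lemma vertical_twisted rho : twisted_section 3 rho (vertical rho).
Proof.
move=> i /=; split.
- exact: vertical_chart.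
- exact: vertical_chart_Elog.
- exact: vertical_chart_ajets.
- exact: vertical_chart_boundary.
Qed.

End AccelerationField.

Theorem proposition2p24 (R : realType) (d : nat) (d_gt0 : (0 < d)%N)
    (tau beta : 'rV[complex R]_2) (gamma : 'X_{1..2} -> 'X_{1..2})
    (gammaP : @admissible_choice R d tau beta gamma) :
  exists W : 'X_{1..2 < d.+1} -> vfield R d,
    descends tau beta gamma W /\
    forall rho : 'X_{1..2 < d.+1},
      [/\ preserves_boundary rho (corrected tau beta gamma rho),
          preserves_boundary rho (W rho),
          reparam_equivariant (corrected tau beta gamma rho),
          reparam_equivariant (W rho) &
          twisted_section 3 rho (W rho)].
Proof.
exists (vertical tau beta gamma); split; first exact: vertical_descends.
move=> rho; split.
- exact: corrected_boundary.
- exact: vertical_boundary.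
- exact: corrected_reparam.
- exact: vertical_reparam.
- exact: vertical_twisted.
Qed.
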